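(* Let $(\mathfrak{g},\rho,V,\mathcal{V},B_0)$ be a standard pentad over a field $\mathfrak{k}$, with $n$-graduations $V_n$ ($n\in\mathbb{Z}$). Then the vector space $L(\mathfrak{g},\rho,V,\mathcal{V},B_0)=\bigoplus_{n\in\mathbb{Z}}V_n$, equipped with the bilinear map $[\cdot,\cdot]$ given by $[x_n,y_m]:=[x_n,y_m]^n_m$ for $x_n\in V_n$, $y_m\in V_m$, $n,m\in\mathbb{Z}$, is a graded Lie algebra (with grading by the subspaces $V_n$).
   Context: All objects are over a field $\mathfrak{k}$ (of arbitrary characteristic) and may be infinite-dimensional. A representation of a Lie algebra $\mathfrak{l}$ on $V$ is written as a linear map $\rho:\mathfrak{l}\otimes V\to V$. A Lie algebra $\mathfrak{l}$ is called graded if $\mathfrak{l}=\bigoplus_{n\in\mathbb{Z}}\mathfrak{l}_n$ with $[\mathfrak{l}_n,\mathfrak{l}_m]\subset\mathfrak{l}_{n+m}$ and $\mathfrak{l}$ is generated by $\mathfrak{l}_{-1}\oplus\mathfrak{l}_0\oplus\mathfrak{l}_1$. Standard pentad $(\mathfrak{g},\rho,V,\mathcal{V},B_0)$: $\mathfrak{g}$ is a non-zero Lie algebra with a non-degenerate invariant bilinear form $B_0$ (i.e. $B_0([a,b],c)=B_0(a,[b,c])$; not assumed symmetric), $\rho:\mathfrak{g}\otimes V\to V$ is a representation, $\mathcal{V}$ is a $\mathfrak{g}$-submodule of $\mathrm{Hom}(V,\mathfrak{k})$ with canonical representation $\varrho$ (so $\langle\rho(a\otimes v),\phi\rangle=-\langle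 v,\varrho(a\otimes\phi)\rangle$ for the canonical pairing $\langle\cdot,\cdot\rangle$), such that (i) $\langle\cdot,\cdot\rangle$ restricted to $V\times\mathcal{V}$ is non-degenerate, (ii) there is a (necessarily unique) linear map $\Phi_\rho:V\otimes\mathcal{V}\to\mathfrak{g}$, the $\Phi$-map, with $B_0(a,\Phi_\rho(v\otimes\phi))=\langle\rho(a\otimes v),\phi\rangle$ for all $a,v,\phi$. Put $\Psi_\rho(\phi\otimes v):=-\Phi_\rho(v\otimes\phi)$. $n$-graduations: $V_0:=\mathfrak{g}$, $V_1:=V$, $V_{-1}:=\mathcal{V}$, with canonical representations $\rho_0$ (adjoint), $\rho_1=\rho$, $\rho_{-1}=\varrho$. For $x\in V_1$, $y\in V_{-1}$ write $x(y):=\Phi_\rho(x\otimes y)$ and $y(x):=\Psi_\rho(y\otimes x)$, both in $V_0$. Let $p_0(x\otimes a):=-\rho_1(a\otimes x)$, $q_0(y\otimes a):=-\rho_{-1}(a\otimes y)$ for $a\in V_0$. Define $p_1:V_1\otimes V_1\to\mathrm{Hom}(V_{-1},V_1)$ by $p_1(v\otimes u)(\eta)=\rho_1(v(\eta)\otimes u)-\rho_1(u(\eta)\otimes v)$ and $q_{-1}:V_{-1}\otimes V_{-1}\to\mathrm{Hom}(V_1,V_{-1})$ by $q_{-1}(\phi\otimes\psi)(\xi)=\rho_{-1}(\phi(\xi)\otimes\psi)-\rho_{-1}(\psi(\xi)\otimes\phi)$. For $i\ge2$, inductively, $V_i:=\mathrm{Im}\,p_{i-1}\subset\mathrm{Hom}(V_{-1},V_{i-1})$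 and $V_{-i}:=\mathrm{Im}\,q_{-i+1}\subset\mathrm{Hom}(V_1,V_{-i+1})$, which are $\mathfrak{g}$-submodules with representations $\rho_{i},\rho_{-i}$, and $p_i:V_1\otimes V_i\to\mathrm{Hom}(V_{-1},V_i)$, $p_i(v\otimes u)(\eta)=\rho_i(v(\eta)\otimes u)+p_{i-1}(v\otimes u(\eta))$; $q_{-i}:V_{-1}\otimes V_{-i}\to\mathrm{Hom}(V_1,V_{-i})$, $q_{-i}(\phi\otimes\psi)(\xi)=\rho_{-i}(\phi(\xi)\otimes\psi)+q_{-i+1}(\phi\otimes\psi(\xi))$. (All $p_i,q_{-i}$ are $\mathfrak{g}$-module homomorphisms.) Brackets $[\cdot,\cdot]^n_m:V_n\times V_m\to V_{n+m}$: for $a\in V_0$, $x\in V_1$, $y\in V_{-1}$, $z_n\in V_n$, $[a,z_n]^0_n:=\rho_n(a\otimes z_n)$; $[x,z_n]^1_n:=p_n(x\otimes z_n)$ if $n\ge0$ and $:=-z_n(x)$ if $n\le-1$; $[y,z_n]^{-1}_n:=-z_n(y)$ if $n\ge1$ and $:=q_n(y\otimes z_n)$ if $n\le0$. For $i\ge1$, inductively, $[p_i(x\otimes z_i),w_n]^{i+1}_n:=[x,[z_i,w_n]^i_n]^1_{i+n}-[z_i,[x,w_n]^1_n]^i_{n+1}$ and $[q_{-i}(y\otimes\omega_{-i}),w_n]^{-i-1}_n:=[y,[\omega_{-i},w_n]^{-i}_n]^{-1}_{-i+n}-[\omega_{-i},[y,w_n]^{-1}_n]^{-i}_{n-1}$;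 these formulas give well-defined bilinear maps. *)

(* Defs.v *)
From HB Require Import structures.
From mathcomp Require Import all_boot all_order all_algebra.
From mathcomp Require Import boolp classical_sets functions cardinality fsbigop.

Set Implicit Arguments.
Unset Strict Implicit.
Unset Printing Implicit Defensive.

Import GRing.Theory.
Local Open Scope classical_set_scope.
Local Open Scope ring_scope.

(* A linear map out of [U (x) U'] is given by the corresponding bilinear map. *)
Definition bilinear_map (k : fieldType) (U U' W : lmodType k)
    (f : U -> U' -> W) : Prop :=
  (forall u', linear (f^~ u')) /\ (forall u, linear (f u)).

(* [br x x = 0] rather than antisymmetry: the characteristic may be 2. *)
Record lie_bracket (k : fieldType) (L : lmodType k) (br : L -> L -> L) : Prop :=
  LieBracket {
    lie_bilinear : bilinear_map br;
    lie_alternating : forall x, br x x = 0;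
    lie_jacobi : forall x y z,
      br x (br y z) + br y (br z x) + br z (br x y) = 0
  }.

Record lie_representation (k : fieldType) (L M : lmodType k)
    (br : L -> L -> L) (act : L -> M -> M) : Prop := LieRepresentation {
  rep_bilinear : bilinear_map act;
  rep_bracket : forall a b m,
    act (br a b) m = act a (act b m) - act b (act a m)
}.

Definition subspace (k : fieldType) (L : lmodType k) (S : set L) : Prop :=
  S 0 /\ forall (c : k) x y, S x -> S y -> S (c *: x + y).

Definition lie_subalgebra (k : fieldType) (L : lmodType k)
    (br : L -> L -> L) (S : set L) : Prop :=
  subspace S /\ forall x y, S x -> S y -> S (br x y).

Definition internal_direct_sum (k : fieldType) (L : lmodType k)
    (comp : int -> set L) : Prop :=
  (forall n, subspace (comp n)) /\
  forall x : L, exists! c : int -> L,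
    [/\ forall n, comp n (c n), finite_set [set n | c n != 0]
      & x = \sum_(n \in [set n | c n != 0]) c n].

Record graded_lie_algebra (k : fieldType) (L : lmodType k)
    (br : L -> L -> L) (comp : int -> set L) : Prop := GradedLieAlgebra {
  graded_lie : lie_bracket br;
  graded_sum : internal_direct_sum comp;
  graded_bracket : forall n m x y,
    comp n x -> comp m y -> comp (n + m) (br x y);
  graded_generated : forall S : set L, lie_subalgebra br S ->
    comp (-1) `<=` S -> comp 0 `<=` S -> comp 1 `<=` S -> forall x, S x
}.

Section LinearFacts.
Variables (k : fieldType) (U W : lmodType k) (f : U -> W).
Hypothesis flin : linear f.

Lemma lin0 : f 0 = 0.
Proof. by have := flin (-1) 0 0; rewrite scaler0 addr0 scaleN1r addNr. Qed.

Lemma linD : {morph f : x y / x + y}.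
Proof. by move=> x y; have := flin 1 x y; rewrite !scale1r. Qed.

Lemma linZ c : {morph f : x / c *: x}.
Proof. by move=> x; have := flin c x 0; rewrite lin0 !addr0. Qed.

Lemma linN : {morph f : x / - x}.
Proof. by move=> x; rewrite -!scaleN1r linZ. Qed.

Lemma linB : {morph f : x y / x - y}.
Proof. by move=> x y; rewrite linD linN. Qed.

End LinearFacts.

Lemma bilinN (k : fieldType) (U U' W : lmodType k) (f : U -> U' -> W) :
  bilinear_map f -> bilinear_map (fun x y => - f x y).
Proof.
by move=> [fl fr]; split=> x c y z; rewrite ?fl ?fr opprD scalerN.
Qed.

Lemma bilinS (k : fieldType) (U U' W : lmodType k) (f : U -> U' -> W) :
  bilinear_map f -> bilinear_map (fun y x => f x y).
Proof. by move=> [fl fr]; split. Qed.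

Definition sub_of (k : fieldType) (U : lmodType k) (S : submodClosed U) : Type :=
  {u : U | u \in S}.

Section SubOf.
Variables (k : fieldType) (U : lmodType k) (S : submodClosed U).
HB.instance Definition _ := SubType.copy (sub_of S) {u : U | u \in S}.
HB.instance Definition _ := [Choice of sub_of S by <:].
HB.instance Definition _ := [SubChoice_isSubLmodule of sub_of S by <:].
End SubOf.

Record standard_pentad (k : fieldType) := StandardPentad {
  sp_g : lmodType k;
  sp_br : sp_g -> sp_g -> sp_g;
  sp_V : lmodType k;
  sp_rho : sp_g -> sp_V -> sp_V;
  sp_dual : submodClosed (sp_V -> k^o);
  sp_B0 : sp_g -> sp_g -> k^o;
  sp_lie : lie_bracket sp_br;
  sp_g_neq0 : exists a : sp_g, a != 0;
  sp_B0_bilinear : bilinear_map sp_B0;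
  sp_B0_invariant : forall a b c,
    sp_B0 (sp_br a b) c = sp_B0 a (sp_br b c);
  sp_B0_nondegl : forall a, (forall b, sp_B0 a b = 0) -> a = 0;
  sp_B0_nondegr : forall b, (forall a, sp_B0 a b = 0) -> b = 0;
  sp_rho_rep : lie_representation sp_br sp_rho;
  sp_dual_linear : forall phi, phi \in sp_dual -> linear phi;
  sp_dual_stable : forall a phi, phi \in sp_dual ->
    (fun v => - phi (sp_rho a v)) \in sp_dual;
  sp_pair_nondegl : forall v,
    (forall phi, phi \in sp_dual -> phi v = 0) -> v = 0;
  sp_pair_nondegr : forall phi, phi \in sp_dual ->
    (forall v, phi v = 0) -> phi = 0;
  sp_Phi_exists : exists Phi : sp_V -> sub_of sp_dual -> sp_g,
    bilinear_map Phi /\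
    forall a v phi, sp_B0 a (Phi v phi) = val phi (sp_rho a v)
}.

Definition sp_Phi (k : fieldType) (P : standard_pentad k) :
    sp_V P -> sub_of (sp_dual P) -> sp_g P :=
  sval (cid (sp_Phi_exists P)).

Definition sp_varrho (k : fieldType) (P : standard_pentad k)
    (a : sp_g P) (phi : sub_of (sp_dual P)) : sub_of (sp_dual P) :=
  exist (fun psi => psi \in sp_dual P) _ (sp_dual_stable a (valP phi)).

(* The positive and negative graduations arise from the same construction,
   applied to [(V, calV, Phi)] and to [(calV, V, Psi)] respectively.
   [md_mom x y] is the element [x(y)] of the Lie algebra. *)
Record moment_data (k : fieldType) (g : lmodType k) (br : g -> g -> g) :=
  MomentData {
    md_A : lmodType k;
    md_B : lmodType k;
    md_actA : g -> md_A -> md_A;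
    md_actB : g -> md_B -> md_B;
    md_mom : md_A -> md_B -> g;
    md_repA : lie_representation br md_actA;
    md_repB : lie_representation br md_actB;
    md_bilinear : bilinear_map md_mom;
    md_equivariant : forall a x y,
      br a (md_mom x y) = md_mom (md_actA a x) y + md_mom x (md_actB a y)
  }.

(* A graduation [V_i] ([i >= 1]), its representation [rho_i] and the map [p_i]
   from [V_1 (x) V_i] to [Hom(V_{-1}, V_i)]; the propositional fields are the
   properties of [rho_i] and [p_i] that make [V_{i+1}] a [g]-module. *)
Record graduation (k : fieldType) (g : lmodType k) (br : g -> g -> g)
    (D : moment_data br) := Graduation {
  gr_sort : lmodType k;
  gr_act : g -> gr_sort -> gr_sort;
  gr_map : md_A D -> gr_sort -> (md_B D -> gr_sort);
  gr_rep : lie_representation br gr_act;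
  gr_bilinear : bilinear_map gr_map;
  gr_linear : forall x z, linear (gr_map x z);
  gr_equivariant : forall a x z y,
    gr_act a (gr_map x z y) = gr_map (md_actA a x) z y +
      gr_map x (gr_act a z) y + gr_map x z (md_actB a y)
}.

Section Graduations.
Variables (k : fieldType) (g : lmodType k) (br : g -> g -> g).
Variable D : moment_data br.
Local Notation A := (md_A D).
Local Notation B := (md_B D).

Lemma rep_comm (M : lmodType k) (act : g -> M -> M) :
  lie_representation br act -> forall a b m,
  act a (act b m) = act (br a b) m + act b (act a m).
Proof. by move=> h a b m; rewrite (rep_bracket h) subrK. Qed.

(* [p_1] has its own formula; [p_0] is only used in [br1] and [brN1]. *)
Definition gr1_map (v u : A) : B -> A := fun eta =>
  md_actA (md_mom v eta) u - md_actA (md_mom u eta) v.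

Lemma gr1_bilinear : bilinear_map gr1_map.
Proof.
have [al ar] := rep_bilinear (md_repA D); have [ml mr] := md_bilinear D.
split=> [u c v v'|v c u u']; apply/funext => eta.
  rewrite [RHS](_ : _ = c *: gr1_map v u eta + gr1_map v' u eta) //.
  by rewrite /gr1_map ml al ar scalerBr opprD addrACA.
rewrite [RHS](_ : _ = c *: gr1_map v u eta + gr1_map v u' eta) //.
by rewrite /gr1_map ml al ar scalerBr opprD addrACA.
Qed.

Lemma gr1_linear v u : linear (gr1_map v u).
Proof.
have [al ar] := rep_bilinear (md_repA D); have [ml mr] := md_bilinear D.
by move=> c y y'; rewrite /gr1_map !mr !al scalerBr opprD addrACA.
Qed.

Lemma gr1_equivariant a x z y :
  md_actA a (gr1_map x z y) = gr1_map (md_actA a x) z y +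
    gr1_map x (md_actA a z) y + gr1_map x z (md_actB a y).
Proof.
have [[al ar] bA] := md_repA D.
rewrite /gr1_map (linB (ar a)) (rep_comm (md_repA D) a _ z)
  (rep_comm (md_repA D) a _ x) !md_equivariant.
rewrite !(linD (al _)) !opprD.
by rewrite [LHS](AC (3*3) ((1*6)*(3*4)*(2*5))).
Qed.

Definition gr1 : graduation D :=
  Graduation (md_repA D) gr1_bilinear gr1_linear gr1_equivariant.

Section Next.
Variable G : graduation D.
Local Notation M := (gr_sort G).

(* The image of [p_i]: it is a map on a tensor product, so its values are
   finite sums of values on pure tensors. *)
Definition im_pred : {pred (B -> M)} := fun f =>
  `[< exists s : seq (A * M), f = \sum_(xz <- s) gr_map xz.1 xz.2 >].

Lemma im_closed : subsemimod_closed im_pred.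
Proof.
split; first split.
- by apply/asboolP; exists [::]; rewrite big_nil.
- move=> f h /asboolP[s ->] /asboolP[t ->]; apply/asboolP.
  by exists (s ++ t); rewrite big_cat.
- move=> c f /asboolP[s ->]; apply/asboolP.
  exists [seq (c *: xz.1, xz.2) | xz <- s]; rewrite big_map scaler_sumr.
  by apply: eq_bigr => -[x z] _ /=; rewrite (linZ ((gr_bilinear G).1 z)).
Qed.
HB.instance Definition _ :=
  GRing.isSubSemiModClosed.Build k (B -> M) im_pred im_closed.

Definition im : lmodType k := sub_of im_pred.

Lemma im_gen x z : gr_map x z \in im_pred.
Proof. by apply/asboolP; exists [:: (x, z)]; rewrite big_seq1. Qed.

Lemma im_linear f : f \in im_pred -> linear f.
Proof.
move=> /asboolP[s ->] c y y'; elim: s => [|xz s IHs].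
  by rewrite !big_nil [LHS](_ : _ = 0) // [RHS]addr0 [RHS]scaler0.
rewrite !big_cons [LHS](_ : _ = gr_map xz.1 xz.2 (c *: y + y') +
  (\sum_(j <- s) gr_map j.1 j.2) (c *: y + y')) // IHs gr_linear.
by rewrite addrACA -scalerDr.
Qed.

Definition im_map (x : A) (z : M) : im :=
  exist (fun f => f \in im_pred) _ (im_gen x z).

(* A representative in the tensor product of an element of the image. *)
Definition im_repr (f : im) : seq (A * M) := sval (cid (asboolW (valP f))).

Definition hom_act (a : g) (f : B -> M) : B -> M := fun y =>
  gr_act a (f y) - f (md_actB a y).

Lemma hom_actD a : {morph hom_act a : f h / f + h}.
Proof.
move=> f h; apply/funext => y; rewrite /hom_act.
rewrite (linD ((rep_bilinear (gr_rep G)).2 a) (f y) (h y)).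
rewrite [X in _ - X](_ : _ = f (md_actB a y) + h (md_actB a y)) //.
by rewrite opprD addrACA.
Qed.

Lemma hom_act_gen a x z : hom_act a (gr_map x z) =
  gr_map (md_actA a x) z + gr_map x (gr_act a z).
Proof. by apply/funext => y; rewrite /hom_act gr_equivariant addrK. Qed.

Lemma im_act_stable a f : f \in im_pred -> hom_act a f \in im_pred.
Proof.
move=> /asboolP[s ->]; elim: s => [|[x z] s IHs].
  rewrite big_nil (_ : hom_act a 0 = 0) ?rpred0 //; apply/funext => y.
  rewrite /hom_act [X in gr_act a X](_ : _ = 0) //.
  by rewrite (lin0 ((rep_bilinear (gr_rep G)).2 a)) subr0.
rewrite big_cons hom_actD rpredD // hom_act_gen rpredD ?im_gen //.
Qed.

Definition im_act (a : g) (f : im) : im :=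
  exist (fun f => f \in im_pred) _ (im_act_stable a (valP f)).

Definition next_map (v : A) (u : im) : B -> im := fun eta =>
  im_act (md_mom v eta) u + im_map v (val u eta).

Lemma im_rep : lie_representation br im_act.
Proof.
have [[al ar] ab] := gr_rep G; have [[bl br'] bb] := md_repB D.
split=> [|a b f].
  split=> [f c a b|a c f h]; apply/val_inj/funext => y /=.
    rewrite [RHS](_ : _ = c *: hom_act a (val f) y + hom_act b (val f) y) //.
    by rewrite /hom_act al bl (im_linear (valP f)) scalerBr opprD addrACA.
  rewrite [RHS](_ : _ = c *: hom_act a (val f) y + hom_act a (val h) y) //.
  rewrite /hom_act (ar a c (val f y) (val h y)) scalerBr.
  by rewrite addrACA -opprD.
apply/val_inj/funext => y /=.
rewrite [RHS](_ : _ = hom_act a (hom_act b (val f)) y -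
  hom_act b (hom_act a (val f)) y) //.
have lf := im_linear (valP f).
rewrite /hom_act ab bb !(linB (ar _)) !(linB lf) !opprD !opprK.
rewrite [RHS](AC ((2*2)*(2*2)) ((1*5)*(8*4)*((2*7)*(3*6)))) /=.
by rewrite !addNr !addr0.
Qed.

Lemma im_map_bilinear : bilinear_map im_map.
Proof.
by have [l r] := gr_bilinear G; split=> ? ? ? ?; apply/val_inj; rewrite /= ?l ?r.
Qed.

Lemma im_act_gen a x z : im_act a (im_map x z) =
  im_map (md_actA a x) z + im_map x (gr_act a z).
Proof. by apply/val_inj; rewrite /= hom_act_gen. Qed.

Lemma next_bilinear : bilinear_map next_map.
Proof.
have [il ir] := rep_bilinear im_rep; have [ml mr] := md_bilinear D.
have [jl jr] := im_map_bilinear.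
split=> [u c v v'|v c u u']; apply/funext => eta.
  rewrite [RHS](_ : _ = c *: next_map v u eta + next_map v' u eta) //.
  by rewrite /next_map ml il jl scalerDr addrACA.
rewrite [RHS](_ : _ = c *: next_map v u eta + next_map v u' eta) //.
by rewrite /next_map ir (jr v c (val u eta) (val u' eta)) scalerDr addrACA.
Qed.

Lemma next_linear v u : linear (next_map v u).
Proof.
have [il ir] := rep_bilinear im_rep; have [ml mr] := md_bilinear D.
have [jl jr] := im_map_bilinear.
move=> c y y'; rewrite /next_map mr il (im_linear (valP u)) jr.
by rewrite scalerDr addrACA.
Qed.

Lemma next_equivariant a x z y :
  im_act a (next_map x z y) = next_map (md_actA a x) z y +
    next_map x (im_act a z) y + next_map x z (md_actB a y).
Proof.
have [il ir] := rep_bilinear im_rep; have [jl jr] := im_map_bilinear.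
rewrite /next_map (linD (ir a)) (rep_comm im_rep) im_act_gen md_equivariant.
rewrite (linD (il _)) [val (im_act a z) y](_ : _ = hom_act a (val z) y) //.
rewrite /hom_act (linB (jr x)).
by rewrite [RHS](AC (2*(1*2)*2) (1*6*3*(2*4)*(5*7))) /= addNr addr0.
Qed.

Definition gr_next : graduation D :=
  Graduation im_rep next_bilinear next_linear next_equivariant.

End Next.

(* [gr i] is the graduation of index [i + 1]. *)
Fixpoint gr (i : nat) : graduation D :=
  if i is j.+1 then gr_next (gr j) else gr1.

Definition gr_below (i : nat) : lmodType k :=
  if i is j.+1 then gr_sort (gr j) else g.

(* For [z] of index [i + 1], [gr_eval z y] is [z(y)], of index [i]. *)
Definition gr_eval (i : nat) : gr_sort (gr i) -> B -> gr_below i :=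
  match i with
  | 0 => fun z y => md_mom z y
  | j.+1 => fun z y => val z y
  end.

End Graduations.

Section Pentad.
Variables (k : fieldType) (P : standard_pentad k).
Local Notation g := (sp_g P).
Local Notation calV := (sub_of (sp_dual P)).

Definition sp_Psi (phi : calV) (v : sp_V P) : g := - sp_Phi v phi.

Lemma sp_varrho_rep : lie_representation (@sp_br k P) (@sp_varrho k P).
Proof.
have [[al ar] ab] := sp_rho_rep P.
split=> [|a b phi].
  split=> [phi c a b|a c phi psi]; apply/val_inj/funext => v /=.
    rewrite [RHS](_ : _ = c *: (- val phi (sp_rho a v)) +
       - val phi (sp_rho b v)) //.
    by rewrite al (sp_dual_linear (valP phi)) opprD scalerN.
  rewrite [RHS](_ : _ = c *: (- val phi (sp_rho a v)) +
     - val psi (sp_rho a v)) //.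
  by rewrite [X in - X](_ : _ = c *: val phi (sp_rho a v) +
    val psi (sp_rho a v)) // opprD scalerN.
apply/val_inj/funext => v /=.
rewrite [RHS](_ : _ = - - val phi (sp_rho b (sp_rho a v)) -
  - - val phi (sp_rho a (sp_rho b v))) //.
by rewrite ab (linB (sp_dual_linear (valP phi))) opprB !opprK.
Qed.

Lemma sp_Phi_bilinear : bilinear_map (@sp_Phi k P).
Proof. by have [] := svalP (cid (sp_Phi_exists P)). Qed.

Lemma sp_PhiE (a : g) (v : sp_V P) (phi : calV) :
  sp_B0 a (sp_Phi v phi) = val phi (sp_rho a v).
Proof. by have [_ ->] := svalP (cid (sp_Phi_exists P)). Qed.

Lemma sp_Phi_equivariant (a : g) (v : sp_V P) (phi : calV) :
  sp_br a (sp_Phi v phi) = sp_Phi (sp_rho a v) phi + sp_Phi v (sp_varrho a phi).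
Proof.
apply/eqP; rewrite -subr_eq0; apply/eqP/sp_B0_nondegr => b.
have [bl br] := sp_B0_bilinear P; have [[al ar] ab] := sp_rho_rep P.
rewrite (linB (br b)) (linD (br b)) -sp_B0_invariant !sp_PhiE ab /=.
by rewrite (linB (sp_dual_linear (valP phi))) subrr.
Qed.

Lemma sp_Psi_bilinear : bilinear_map sp_Psi.
Proof. exact: bilinN (bilinS sp_Phi_bilinear). Qed.

Lemma sp_Psi_equivariant (a : g) (phi : calV) (v : sp_V P) :
  sp_br a (sp_Psi phi v) = sp_Psi (sp_varrho a phi) v + sp_Psi phi (sp_rho a v).
Proof.
have [_ br] := lie_bilinear (sp_lie P).
by rewrite /sp_Psi (linN (br a)) sp_Phi_equivariant opprD addrC.
Qed.

Definition posD : moment_data (@sp_br k P) := MomentData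
  (sp_rho_rep P) sp_varrho_rep sp_Phi_bilinear sp_Phi_equivariant.
Definition negD : moment_data (@sp_br k P) := MomentData
  sp_varrho_rep (sp_rho_rep P) sp_Psi_bilinear sp_Psi_equivariant.

(* [Negz i] is the integer [- (i + 1)]. *)
Definition Vn (n : int) : lmodType k :=
  match n with
  | Posz 0 => g
  | Posz i.+1 => gr_sort (gr posD i)
  | Negz i => gr_sort (gr negD i)
  end.

Definition castV (n m : int) (e : n = m) : Vn n -> Vn m :=
  fun z => eq_rect n (fun l => Vn l) z m e.

Definition br0 (n : int) (a : g) : Vn n -> Vn n :=
  match n with
  | Posz 0 => fun b => sp_br a b
  | Posz i.+1 => fun z => gr_act a z
  | Negz i => fun z => gr_act a z
  end.

Lemma add1Negz (i : nat) : Negz i = 1 + Negz i.+1.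
Proof. by rewrite !NegzE [in RHS]intS opprD addrA subrr add0r. Qed.

(* [[x, z]] for [x] in [V_1], [z] in [V_n]: [p_n(x (x) z)] if [n >= 0] and
   [- z(x)] otherwise. *)
Definition br1 (n : int) (x : sp_V P) : Vn n -> Vn (1 + n) :=
  match n return Vn n -> Vn (1 + n) with
  | Posz 0 => fun a : g => - sp_rho a x
  | Posz i.+1 => fun z => im_map (D := posD) x z
  | Negz 0 => fun z => - gr_eval (D := negD) (i := 0) z x
  | Negz i.+1 => fun z =>
      castV (add1Negz i) (- gr_eval (D := negD) (i := i.+1) z x)
  end.

Lemma subN1S (i : nat) : Posz i = -1 + Posz i.+1.
Proof. by rewrite intS addrA addNr add0r. Qed.

Lemma subN1N (i : nat) : Negz i.+1 = -1 + Negz i.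
Proof. by rewrite !NegzE intS opprD. Qed.

(* [[y, z]] for [y] in [V_{-1}], [z] in [V_n]: [q_n(y (x) z)] if [n <= 0] and
   [- z(y)] otherwise. *)
Definition brN1 (n : int) (y : calV) : Vn n -> Vn (-1 + n) :=
  match n return Vn n -> Vn (-1 + n) with
  | Posz 0 => fun a : g => - sp_varrho a y
  | Posz 1 => fun z => - gr_eval (D := posD) (i := 0) z y
  | Posz i.+2 => fun z =>
      castV (subN1S i.+1) (- gr_eval (D := posD) (i := i.+1) z y)
  | Negz i => fun z => castV (subN1N i) (im_map (D := negD) y z)
  end.

Lemma posA (i : nat) (n : int) : 1 + (Posz i.+1 + n) = Posz i.+2 + n.
Proof. by rewrite addrA -intS. Qed.

Lemma posCA (i : nat) (n : int) : Posz i.+1 + (1 + n) = Posz i.+2 + n.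
Proof. by rewrite addrCA posA. Qed.

Lemma negA (i : nat) (n : int) : -1 + (Negz i + n) = Negz i.+1 + n.
Proof. by rewrite addrA -subN1N. Qed.

Lemma negCA (i : nat) (n : int) : Negz i + (-1 + n) = Negz i.+1 + n.
Proof. by rewrite addrCA negA. Qed.

(* [[z, w]] for [z] in [V_{i+1}], [w] in [V_n]. The defining formula on
   [p_i(x (x) z_i)] is extended to a sum of such elements by linearity, using a
   chosen representative of [z] in [V_1 (x) V_i]; the Lie algebra axioms imply
   that the value does not depend on this choice. *)
Fixpoint br_pos (i : nat) :
    forall n, gr_sort (gr posD i) -> Vn n -> Vn (Posz i.+1 + n) :=
  match i with
  | 0 => fun n x w => br1 x w
  | j.+1 => fun n z w => \sum_(xz <- im_repr z)
      (castV (posA j n) (br1 xz.1 (br_pos xz.2 w)) -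
       castV (posCA j n) (br_pos xz.2 (br1 xz.1 w)))
  end.

(* [[z, w]] for [z] in [V_{-(i+1)}], [w] in [V_n]. *)
Fixpoint br_neg (i : nat) :
    forall n, gr_sort (gr negD i) -> Vn n -> Vn (Negz i + n) :=
  match i with
  | 0 => fun n y w => brN1 y w
  | j.+1 => fun n z w => \sum_(yz <- im_repr z)
      (castV (negA j n) (brN1 yz.1 (br_neg yz.2 w)) -
       castV (negCA j n) (br_neg yz.2 (brN1 yz.1 w)))
  end.

Definition brV (n m : int) : Vn n -> Vn m -> Vn (n + m) :=
  match n return Vn n -> Vn m -> Vn (n + m) with
  | Posz 0 => fun a z => castV (esym (add0r m)) (br0 a z)
  | Posz i.+1 => fun z w => br_pos z w
  | Negz i => fun z w => br_neg z w
  end.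

Definition prodV : Type := forall n : int, Vn n.

HB.instance Definition _ := Choice.copy prodV (forall n : int, Vn n).

Lemma prodV_addA : associative (fun x y : prodV => (fun n => x n + y n) : prodV).
Proof. by move=> *; apply: functional_extensionality_dep => n; exact: addrA. Qed.

Lemma prodV_addC : commutative (fun x y : prodV => (fun n => x n + y n) : prodV).
Proof. by move=> x y; apply: functional_extensionality_dep => n; exact: addrC. Qed.

Lemma prodV_add0 :
  left_id ((fun n => 0) : prodV) (fun x y : prodV => (fun n => x n + y n) : prodV).
Proof. by move=> x; apply: functional_extensionality_dep => n; exact: add0r. Qed.

Lemma prodV_addN : left_inverse ((fun n => 0) : prodV)
  (fun x : prodV => (fun n => - x n) : prodV)
  (fun x y : prodV => (fun n => x n + y n) : prodV).
Proof. by move=> x; apply: functional_extensionality_dep => n; exact: addNr. Qed.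
HB.instance Definition _ := GRing.isZmodule.Build prodV
  prodV_addA prodV_addC prodV_add0 prodV_addN.

Definition scaleV (c : k) (x : prodV) : prodV := fun n => c *: x n.
Lemma prodV_scaleA c d x : scaleV c (scaleV d x) = scaleV (c * d) x.
Proof. by apply: functional_extensionality_dep => n; exact: scalerA. Qed.

Lemma prodV_scale1 : left_id 1 scaleV.
Proof. by move=> x; apply: functional_extensionality_dep => n; exact: scale1r. Qed.

Lemma prodV_scaleDr : right_distributive scaleV +%R.
Proof. by move=> c x y; apply: functional_extensionality_dep => n; exact: scalerDr. Qed.

Lemma prodV_scaleDl x : {morph scaleV^~ x : c d / c + d}.
Proof. by move=> c d; apply: functional_extensionality_dep => n; exact: scalerDl. Qed.
HB.instance Definition _ := GRing.Zmodule_isLmodule.Build k prodV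
  prodV_scaleA prodV_scale1 prodV_scaleDr prodV_scaleDl.

Definition supp (x : prodV) : set int := [set n | x n != 0].

Definition fin_supp : {pred prodV} := fun x => `[< finite_set (supp x) >].

Lemma fin_supp_closed : subsemimod_closed fin_supp.
Proof.
split; first split.
- apply/asboolP; rewrite (_ : supp 0 = set0) //.
  by apply/seteqP; split => n //=; rewrite /supp /= eqxx.
- move=> x y /asboolP fx /asboolP fy; apply/asboolP.
  apply: (sub_finite_set (B := supp x `|` supp y)); last by rewrite finite_setU.
  move=> n; rewrite /supp /=; have [xn0|] := eqVneq (x n) 0; last by left.
  have [yn0|] := eqVneq (y n) 0; last by right.
  by rewrite [(x + y) n](_ : _ = x n + y n) // xn0 yn0 addr0 eqxx.
- move=> c x /asboolP fx; apply/asboolP.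
  apply: (sub_finite_set (B := supp x)) => // n; rewrite /supp /=.
  apply: contraNneq => xn0.
  by rewrite [(c *: x) n](_ : _ = c *: x n) // xn0 scaler0.
Qed.
HB.instance Definition _ :=
  GRing.isSubSemiModClosed.Build k prodV fin_supp fin_supp_closed.

Definition Lsum : lmodType k := sub_of fin_supp.

Definition inj_fun (n : int) (z : Vn n) : prodV := fun m =>
  if n =P m is ReflectT e then castV e z else 0.

Lemma inj_fin n (z : Vn n) : inj_fun z \in fin_supp.
Proof.
apply/asboolP; apply: (sub_finite_set (B := [set n])) => // m.
by rewrite /supp /inj_fun /=; case: eqP => // _; rewrite eqxx.
Qed.

Definition inj (n : int) (z : Vn n) : Lsum :=
  exist (fun x => x \in fin_supp) (inj_fun z) (inj_fin z).

Definition Lcomp (n : int) : set Lsum := range (@inj n).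

(* The bilinear extension of the brackets [brV]. *)
Definition Lbr (x y : Lsum) : Lsum :=
  \sum_(n \in supp (val x)) \sum_(m \in supp (val y))
    inj (brV (val x n) (val y m)).

End Pentad.

(* Main.v *)
From HB Require Import structures.
From mathcomp Require Import all_boot all_order all_algebra.
From mathcomp Require Import finmap.
From mathcomp Require Import boolp classical_sets functions cardinality fsbigop.
Require Import Defs.

(* Let the elements [a] of [V_0], [x] of [V_1] and [y] of [V_{-1}] act on the
   direct sum [L] by operators; these satisfy [[a,b] = ab - ba] and
   [[x,y] = x(y)] as operators.  The operator [ad z] of an element [z] of
   [V_{i+1}] is a sum of commutators [[x, ad z']], and the only difficulty is
   that it depends on [z] alone.  If [sum p_i(x (x) z') = 0], the operator
   [f = sum [x, ad z']] commutes with [V_{-1}], and kills [V_0], [V_{-1}], hence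
   every [V_{-n}]; it then kills [V_n] ([n > 0]) by induction on [n], because an
   element [u] of [V_j] with [j >= 2] and [u(y) = 0] for all [y] vanishes by the
   very definition of [V_j].  The same transitivity argument gives
   [[z,x] = -[x,z]] and, in any characteristic, [[z,z] = 0].  The elements [u]
   for which [ad [u,w] = [ad u, ad w]] for all [w] form a subalgebra, and so do
   those with [[u,w] = -[w,u]] for all [w]; both contain [V_{-1}], [V_0] and
   [V_1], which generate [L]. *)

Set Implicit Arguments.
Unset Strict Implicit.
Unset Printing Implicit Defensive.

Import GRing.Theory.
Local Open Scope ring_scope.

(** * Evaluation and the maps p_i, uniformly from degree 0 on *)

Section MomentData.
Variables (k : fieldType) (g : lmodType k) (br : g -> g -> g).
Hypothesis br_lie : lie_bracket br.
Variable D : moment_data br.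
Local Notation A := (md_A D).
Local Notation B := (md_B D).
Local Notation V i := (gr_sort (gr D i)).
Local Notation W i := (gr_below D i).

Lemma lie_skew (a b : g) : br a b = - br b a.
Proof.
have [[bl br'] ba _] := br_lie.
have := ba (a + b); rewrite (linD (bl _)) !(linD (br' _)) !ba add0r addr0.
by move/eqP; rewrite addr_eq0 => /eqP.
Qed.

Lemma lie_leibniz (a b c : g) : br a (br b c) = br (br a b) c + br b (br a c).
Proof.
have [[bl br'] _ bj] := br_lie.
have := bj a b c; rewrite (lie_skew c a) (linN (br' b)) (lie_skew c).
by move/eqP; rewrite subr_eq0 => /eqP <-; rewrite subrK.
Qed.

Definition below_act i : g -> W i -> W i :=
  if i is j.+1 then @gr_act k g br D (gr D j) else br.

(* [below_map i] is [p_i], from [V_1 (x) V_i] to [V_{i+1}], including [p_0]. *)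
Definition below_map i : A -> W i -> V i :=
  match i return A -> W i -> V i with
  | 0 => fun x a => - md_actA a x
  | j.+1 => fun x z => im_map x z
  end.

(** The formula for p_1 also has the inductive shape, its second term being p_0 of [x] and z(y); one
    recursion thus serves all degrees. *)
Lemma gr_mapE i x (z : V i) y :
  gr_map x z y = gr_act (md_mom x y) z + below_map x (gr_eval z y).
Proof. by case: i z. Qed.

Lemma gr_eval_bilinear i : bilinear_map (@gr_eval k g br D i).
Proof.
case: i => [|i]; first exact: md_bilinear.
by split=> [y c z z'|z c y y'] //=; apply: im_linear (valP z) _ _ _.
Qed.

Lemma gr_eval_equivariant i a (z : V i) y :
  below_act a (gr_eval z y) =
    gr_eval (gr_act a z) y + gr_eval z (md_actB a y).
Proof.
by case: i z => [|i] z /=; rewrite ?md_equivariant // /hom_act subrK.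
Qed.

(** Transitivity: from degree 2 on, elements are functions on V_{-1} by construction. Degree 1 is
    excluded, since [md_mom x] may vanish for a non-zero [x]. *)
Lemma gr_eval_inj i (z : V i.+1) : (forall y, gr_eval z y = 0) -> z = 0.
Proof. by move=> z0; apply/val_inj/funext => y; exact: z0. Qed.

Lemma below_map_equivariant i a x (b : W i) :
  gr_act a (below_map x b) =
    below_map (md_actA a x) b + below_map x (below_act a b).
Proof.
case: i b => [|i] b /=; last exact: im_act_gen.
have [[al ar] ab] := md_repA D.
by rewrite (linN (ar a)) (rep_comm (md_repA D)) opprD addrC.
Qed.

Lemma im_map0C x y : im_map (G := gr D 0) x y = - im_map (G := gr D 0) y x.
Proof. by apply/val_inj/funext => b; rewrite /= /gr1_map -opprB. Qed.

Lemma im_map0_diag x : im_map (G := gr D 0) x x = 0.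
Proof. by apply/val_inj/funext => b; rewrite /= /gr1_map subrr. Qed.

Lemma im_reprE i (z : V i.+1) :
  val z = \sum_(xz <- im_repr z) gr_map xz.1 xz.2.
Proof. exact: svalP (cid (asboolW (valP z))). Qed.

Lemma im_repr_sum i (z : V i.+1) :
  z = \sum_(xz <- im_repr z) im_map xz.1 xz.2.
Proof. by apply/val_inj; rewrite raddf_sum im_reprE. Qed.

End MomentData.

(** * Cancellation in abelian groups, sums of linear maps *)

Lemma pull_summand (V : zmodType) (s s' c t : V) :
  s = s' + t -> s + c = s' + c + t.
Proof. by move=> ->; rewrite addrAC. Qed.

Lemma cancel_pos (V : zmodType) (s s' t : V) :
  s = s' - t -> s' = 0 -> s + t = 0.
Proof. by move=> -> ->; rewrite add0r addNr. Qed.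

Lemma cancel_neg (V : zmodType) (s s' t : V) :
  s = s' + t -> s' = 0 -> s - t = 0.
Proof. by move=> -> ->; rewrite add0r subrr. Qed.

(** Solves [s = ?r + t], for [t] a known summand of [s], by building [?r] as [s] without [t]. *)
Ltac pull :=
  match goal with
  | |- _ + ?t = _ + ?t' => unify t t'; reflexivity
  | _ => eapply pull_summand; pull
  end.

(* Proves an identity between signed sums in an abelian group by cancelling
   the last summand against its opposite, repeatedly. *)
Ltac abel :=
  apply: subr0_eq; rewrite ?subr0 -[LHS]add0r !(opprD, opprK) !addrA;
  repeat first [ eapply cancel_neg; [solve [pull] |]
               | eapply cancel_pos; [solve [pull] |] ];
  reflexivity.

Lemma lin_sum (k : fieldType) (U W : lmodType k) (f : U -> W) (I : Type) :
  linear f -> forall (s : seq I) (F : I -> U),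
  f (\sum_(i <- s) F i) = \sum_(i <- s) f (F i).
Proof. by move=> flin s F; apply: big_morph; [exact: linD | exact: lin0]. Qed.

Lemma sum_apply (T : Type) (M : zmodType) (I : Type) (s : seq I)
    (F : I -> T -> M) (y : T) :
  (\sum_(i <- s) F i) y = \sum_(i <- s) F i y.
Proof. by rewrite fct_sumE. Qed.

(** Elements of the image are sums of values on pure tensors, scalars being absorbed into [x]. *)
Lemma im_ind (k : fieldType) (g : lmodType k) (br : g -> g -> g)
    (D : moment_data br) i (Q : gr_sort (gr D i.+1) -> Prop) :
  Q 0 -> (forall z z', Q z -> Q z' -> Q (z + z')) ->
  (forall x (z : gr_sort (gr D i)), Q (im_map x z)) -> forall z, Q z.
Proof.
move=> Q0 QD Qg z; rewrite (im_repr_sum z).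
by elim: (im_repr z) => [|xz s IHs]; rewrite ?big_nil // big_cons; exact: QD.
Qed.

(** * Adjoint operators of the elements of positive degree *)

(* [L] stands for the direct sum, [i0], [iB] and [ip] for its inclusions of
   [V_0], [V_{-1}] and [V_{i+1}], and [H], [X], [Y] for the adjoint operators of
   [V_0], [V_1], [V_{-1}].  Exchanging [X] and [Y], the results also apply to
   the negative graduation. *)
Section OneSidedAdjoint.
Variables (k : fieldType) (g : lmodType k) (br : g -> g -> g).
Variable D : moment_data br.
Local Notation A := (md_A D).
Local Notation B := (md_B D).
Local Notation V i := (gr_sort (gr D i)).
Local Notation W i := (gr_below D i).
Variables (L : lmodType k) (i0 : g -> L) (iB : B -> L).
Variable ip : forall i, V i -> L.
Variables (H : g -> L -> L) (X : A -> L -> L) (Y : B -> L -> L).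

Definition inj_below i : W i -> L := if i is j.+1 then @ip j else i0.

Local Notation ib := inj_below.

Hypotheses (ip_linear : forall i, linear (@ip i))
  (ip_inj : forall i (z : V i), ip z = 0 -> z = 0)
  (H_bilinear : bilinear_map H) (X_bilinear : bilinear_map X)
  (Y_bilinear : bilinear_map Y)
  (X_ib : forall i x (b : W i), X x (ib b) = ip (below_map x b))
  (X_iB : forall x y, X x (iB y) = i0 (md_mom x y))
  (Y_ip : forall i y (z : V i), Y y (ip z) = - ib (gr_eval z y))
  (HX : forall a x w, H a (X x w) = X (md_actA a x) w + X x (H a w))
  (XY : forall x y w, X x (Y y w) = H (md_mom x y) w + Y y (X x w))
  (* [ext] expresses that V_{-1} generates the negative half: an operator that kills V_{-1} and
     commutes with its action kills every V_{-n}. *)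
  (ext : forall f : L -> L, linear f -> (forall y, f (iB y) = 0) ->
     (forall a, f (i0 a) = 0) -> (forall i (z : V i), f (ip z) = 0) ->
     (forall y w, Y y (f w) = f (Y y w)) -> forall w, f w = 0).

(** The recursion of [br_pos], but with operators on all of [L], so that no casts between degrees
    occur. The choice of [im_repr z] is shown to be immaterial in [adS_sum]. *)
Fixpoint ad i : V i -> L -> L :=
  match i return V i -> L -> L with
  | 0 => X
  | j.+1 => fun z w => \sum_(xz <- im_repr z)
      (X xz.1 (ad xz.2 w) - ad xz.2 (X xz.1 w))
  end.

Definition adb i : W i -> L -> L :=
  match i return W i -> L -> L with 0 => H | j.+1 => @ad j end.

(** Bundled for a single induction on [i]. [ad_below], [ad_Y] and [ad_H] are commutators with V_1,
    V_{-1} and V_0; [ad_iB], [ad_i0] and [ad_ip0] are antisymmetry against V_{-1}, V_0 and V_1;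
    [ad_ip] tracks the degree. *)
Record ad_spec i : Prop := AdSpec {
  ad_bilinear : bilinear_map (@ad i);
  ad_below : forall x (b : W i) w,
    ad (below_map x b) w = X x (adb b w) - adb b (X x w);
  ad_Y : forall y (z : V i) w,
    Y y (ad z w) = ad z (Y y w) - adb (gr_eval z y) w;
  ad_H : forall a (z : V i) w,
    H a (ad z w) = ad (gr_act a z) w + ad z (H a w);
  ad_iB : forall (z : V i) y, ad z (iB y) = ib (gr_eval z y);
  ad_i0 : forall (z : V i) a, ad z (i0 a) = - ip (gr_act a z);
  ad_ip0 : forall (z : V i) x,
    ad z (ip (i := 0) x) = - ip (i := i.+1) (im_map x z);
  ad_ip : forall j (z : V i) (w : V j),
    exists u : V (i + j).+1, ad z (ip w) = ip u
}.

Lemma ip_transitive i (z : V i.+1) : (forall y, Y y (ip z) = 0) -> ip z = 0.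
Proof.
move=> Yz; rewrite (gr_eval_inj (z := z)) ?(lin0 (@ip_linear _)) // => y.
by apply: ip_inj; apply/eqP; rewrite -oppr_eq0 -(Y_ip y z) Yz.
Qed.

Lemma ad_spec0 : ad_spec 0.
Proof.
have [Hl Hr] := H_bilinear; have [Xl Xr] := X_bilinear.
split => //=.
- by move=> x b w; rewrite HX opprD addrCA subrr addr0 (linN (Xl _)).
- by move=> y z w; rewrite XY addrC addKr.
- by move=> z a; rewrite -(linN (@ip_linear 0)) -(X_ib (i := 0)).
- move=> z x; rewrite -(linN (@ip_linear 1)) (im_map0C x z) opprK.
  exact: (X_ib (i := 1)).
- by move=> j z w; exists (im_map z w); exact: (X_ib (i := j.+1)).
Qed.

(** * Inductive step: from V_{i+1} to V_{i+2} *)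

Section Step.
Variable i : nat.
Hypothesis IH : ad_spec i.

Definition ad_comm (xz : A * V i) (w : L) : L :=
  X xz.1 (ad xz.2 w) - ad xz.2 (X xz.1 w).

Lemma ad_comm_linear xz : linear (ad_comm xz).
Proof.
have [_ Xr] := X_bilinear; have [_ ar] := ad_bilinear IH.
by move=> c u v; rewrite /ad_comm ar !Xr ar scalerBr opprD addrACA.
Qed.

(** Jacobi for operators: the bracket of y with [x, ad z] is -[x(y), ad z] - [x, ad z(y)], and these
    match the two terms of [gr_mapE]. *)
Lemma ad_comm_Y y xz w :
  Y y (ad_comm xz w) = ad_comm xz (Y y w) - ad (gr_map xz.1 xz.2 y) w.
Proof.
case: xz => x z; rewrite /ad_comm /= gr_mapE.
have [Xl Xr] := X_bilinear; have [al ar] := ad_bilinear IH.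
have [_ Yr] := Y_bilinear.
rewrite (linD (al w)) (ad_below IH) (linB (Yr y)).
have YX x' w' : Y y (X x' w') = X x' (Y y w') - H (md_mom x' y) w'.
  by rewrite XY addrC addKr.
have -> : ad (gr_act (md_mom x y) z) w =
    H (md_mom x y) (ad z w) - ad z (H (md_mom x y) w).
  by rewrite (ad_H IH) addrK.
rewrite YX !(ad_Y IH) YX (linB (Xr _)) (linB (ar z)).
by abel.
Qed.

Lemma ad_comm_gen xz y :
  ip (i := i) (gr_map xz.1 xz.2 y) =
    ip (gr_act (md_mom xz.1 y) xz.2) + ip (below_map xz.1 (gr_eval xz.2 y)).
Proof. by rewrite gr_mapE (linD (@ip_linear i)). Qed.

Lemma ad_comm_iB xz y : ad_comm xz (iB y) = ip (i := i) (gr_map xz.1 xz.2 y).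
Proof.
by rewrite ad_comm_gen /ad_comm (ad_iB IH) X_iB (ad_i0 IH) X_ib opprK addrC.
Qed.

Lemma ad_comm_i0 xz a :
  ad_comm xz (i0 a) = - ip (i := i.+1) (im_act a (im_map xz.1 xz.2)).
Proof.
case: xz => x z; have [_ Xr] := X_bilinear; have [_ ar] := ad_bilinear IH.
rewrite /ad_comm /= (ad_i0 IH) (linN (Xr x)) (X_ib (i := i.+1)) /=.
rewrite (X_ib (i := 0)) /= (linN (@ip_linear 0)) (linN (ar z)) (ad_ip0 IH).
by rewrite opprK im_act_gen (linD (@ip_linear i.+1)) opprD addrC.
Qed.

Lemma ad_comm_ip xz j (w : V j) :
  exists u : V (i.+1 + j).+1, ad_comm xz (ip w) = ip u.
Proof.
case: xz => x z; rewrite /ad_comm /=.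
have [u ->] := ad_ip IH z w.
rewrite (X_ib (i := j.+1)) (X_ib (i := (i + j).+2)).
have := ad_ip IH z (below_map (i := j.+1) x w).
(* [addnS] brings both terms of the commutator into the same graduation. *)
rewrite addnS => -[u' ->]; exists (below_map (i := (i + j).+2) x u - u').
by rewrite (linB (@ip_linear _)).
Qed.

Lemma ad_comm_H a x z w :
  H a (ad_comm (x, z) w) =
    ad_comm (md_actA a x, z) w + ad_comm (x, gr_act a z) w +
      ad_comm (x, z) (H a w).
Proof.
have [_ Hr] := H_bilinear; have [_ Xr] := X_bilinear.
have [_ ar] := ad_bilinear IH.
rewrite /ad_comm /= (linB (Hr a)) HX !(ad_H IH) HX (linD (Xr x)) (linD (ar z)).
by abel.
Qed.

(** This makes the bracket well defined: a relation in V_{i+2} passes to operators. [ext] leaves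
    degrees -1 and 0, read off from the relation itself, and the positive ones, settled by
    transitivity. *)
Lemma ad_comm_sum_eq0 (s : seq (A * V i)) w :
  \sum_(xz <- s) gr_map xz.1 xz.2 = 0 :> (B -> V i) ->
  \sum_(xz <- s) ad_comm xz w = 0.
Proof.
move=> s0; pose f w := \sum_(xz <- s) ad_comm xz w; rewrite -/(f w).
have fY y v : Y y (f v) = f (Y y v).
  have [_ Yr] := Y_bilinear; have [al _] := ad_bilinear IH.
  (* The subtracted 0 is rewritten as [ad] of the vanishing sum evaluated at [y], to match
     [ad_comm_Y] termwise. *)
  rewrite (lin_sum (Yr y)) -[RHS]subr0 -[X in _ - X](lin0 (al v)).
  have s0y : (\sum_(xz <- s) gr_map xz.1 xz.2) y = 0 by rewrite s0.
  rewrite -[X in ad X v]s0y.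
  rewrite sum_apply (lin_sum (al v)) -sumrB.
  by apply: eq_bigr => xz _; exact: ad_comm_Y.
have flin : linear f.
  move=> c u v; rewrite /f scaler_sumr -big_split.
  by apply: eq_bigr => xz _; exact: ad_comm_linear.
have f0 a : f (i0 a) = 0.
  rewrite /f; under eq_bigr do rewrite ad_comm_i0.
  have [_ ar] := rep_bilinear (gr_rep (gr D i.+1)).
  rewrite sumrN -(lin_sum (@ip_linear i.+1)) -(lin_sum (ar a)).
  rewrite [X in gr_act a X](_ : _ = 0).
    by rewrite (lin0 (ar a)) (lin0 (@ip_linear _)) oppr0.
  by apply/val_inj; rewrite raddf_sum /= s0.
apply: ext => //.
- move=> y; rewrite /f; under eq_bigr do rewrite ad_comm_iB.
  rewrite -(lin_sum (@ip_linear i)) -(sum_apply s (fun xz => gr_map xz.1 xz.2)).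
  by rewrite s0 (lin0 (@ip_linear i)).
- have fip j (z : V j) : exists u : V (i.+1 + j).+1, f (ip z) = ip u.
    rewrite /f; elim: s {s0 f fY flin f0} => [|xz s [u IHs]].
      by exists 0; rewrite big_nil (lin0 (@ip_linear _)).
    have [u' e] := ad_comm_ip xz z; exists (u' + u).
    by rewrite big_cons e IHs (linD (@ip_linear _)).
  (* [f (ip z)] has degree at least 2, so it is enough to apply [Y y]; this passes to the argument,
     which drops to the preceding degree, V_0 in the base case. *)
  elim=> [|j IHj] z; have [u e] := fip _ z; rewrite e;
    apply: ip_transitive => y; rewrite -e fY Y_ip (linN flin) /=.
    by rewrite f0 oppr0.
  by rewrite IHj oppr0.
Qed.

(** Two representatives of [z] differ by a relation, formed by negating the V_1 factors of one of
    them. *)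
Lemma adS_sum (s : seq (A * V i)) (z : V i.+1) w :
  val z = \sum_(xz <- s) gr_map xz.1 xz.2 ->
  ad z w = \sum_(xz <- s) ad_comm xz w.
Proof.
move=> zs; have [gl _] := gr_bilinear (gr D i).
have [Xl Xr] := X_bilinear; have [_ ar] := ad_bilinear IH.
have := ad_comm_sum_eq0 (s := im_repr z ++ [seq (- xz.1, xz.2) | xz <- s]) w.
rewrite !big_cat !big_map -im_reprE zs /=.
under [X in _ + X]eq_bigr => xz _ do rewrite (linN (gl _)).
rewrite sumrN subrr => /(_ erefl).
under [X in _ + X]eq_bigr => xz _.
  rewrite /ad_comm /= (linN (Xl _)) (linN (Xl _)) (linN (ar _)) -opprD.
  over.
by rewrite sumrN => /subr0_eq.
Qed.

Lemma adS_gen x z w : ad (i := i.+1) (im_map x z) w = ad_comm (x, z) w.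
Proof. by rewrite (adS_sum (s := [:: (x, z)])) ?big_seq1. Qed.

Lemma adS_bilinear : bilinear_map (@ad i.+1).
Proof.
have [gl _] := gr_bilinear (gr D i); have [Xl Xr] := X_bilinear.
have [_ ar] := ad_bilinear IH.
split=> [w c z z'|z c u v].
  rewrite (adS_sum
    (s := [seq (c *: xz.1, xz.2) | xz <- im_repr z] ++ im_repr z')).
    rewrite big_cat big_map; congr (_ + _); rewrite /= scaler_sumr.
    apply: eq_bigr => xz _; rewrite /ad_comm /= (linZ (Xl _)) (linZ (Xl _)).
    by rewrite (linZ (ar _)) scalerBr.
  rewrite big_cat big_map -im_reprE /=; congr (_ + _).
  rewrite im_reprE scaler_sumr.
  by apply: eq_bigr => xz _; rewrite (linZ (gl _)).
rewrite /= scaler_sumr -big_split.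
by apply: eq_bigr => xz _; exact: ad_comm_linear.
Qed.

Lemma ad_specS : ad_spec i.+1.
Proof.
have [al ar] := adS_bilinear.
have [Hl Hr] := H_bilinear; have [Xl Xr] := X_bilinear.
have [Yl Yr] := Y_bilinear; have [al' ar'] := ad_bilinear IH.
have [gl gr'] := rep_bilinear (gr_rep (gr D i.+1)).
have SY y (z : V i.+1) w :
    Y y (ad z w) = ad z (Y y w) - adb (gr_eval z y) w.
  have [_ Yr'] := Y_bilinear; rewrite [adb _ _]/= im_reprE sum_apply.
  rewrite (lin_sum (al' w)) (lin_sum (Yr y)) -sumrB.
  by apply: eq_bigr => xz _; exact: ad_comm_Y.
have Si0 (z : V i.+1) a : ad z (i0 a) = - ip (gr_act a z).
  elim/im_ind: z => [||x z]; last by rewrite adS_gen ad_comm_i0.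
    by rewrite (lin0 (al _)) (lin0 (gr' a)) (lin0 (@ip_linear _)) oppr0.
  move=> z z' e e'; rewrite (linD (al _)) e e' (linD (gr' a)).
  by rewrite (linD (@ip_linear _)) opprD.
have Sip j (z : V i.+1) (w : V j) :
    exists u : V (i.+1 + j).+1, ad z (ip w) = ip u.
  elim/im_ind: z => [||x z].
  - by exists 0; rewrite (lin0 (al _)) (lin0 (@ip_linear _)).
  - move=> z z' [u e] [u' e']; exists (u + u').
    by rewrite (linD (al _)) e e' (linD (@ip_linear _)).
  - by have [u e] := ad_comm_ip (x, z) w; exists u; rewrite adS_gen.
split=> //.
- by move=> x b w; rewrite [below_map x b]/= adS_gen.
- move=> a z w; elim/im_ind: z => [||x z].
  + by rewrite (lin0 (gr' a)) !(lin0 (al _)) (lin0 (Hr a)) addr0.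
  + move=> z z' e e'; rewrite (linD (gr' a)) !(linD (al _)) (linD (Hr a)).
    by rewrite e e' addrACA.
  + rewrite [gr_act a _]im_act_gen (linD (al _)) !adS_gen.
    exact: ad_comm_H.
- move=> z y; rewrite /= im_reprE sum_apply (lin_sum (@ip_linear i)).
  by apply: eq_bigr => xz _; exact: ad_comm_iB.
(* By transitivity: [Y y] sends [z, x] to x(y).z + [x, z(y)], which is [next_map x z y], and [x, z]
   to its opposite. *)
- move=> z x; apply/eqP; rewrite -addr_eq0; apply/eqP.
  have := Sip 0 z x; rewrite addn0 => -[u e].
  rewrite e -(linD (@ip_linear _)); apply: ip_transitive => y.
  rewrite (linD (@ip_linear _)) -e (linD (Yr y)) SY !Y_ip (linN (ar z)).
  rewrite [ad z _](Si0 z (md_mom x y)) [adb _ _](ad_ip0 IH (val z y) x) !opprK.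
  by rewrite /= /next_map (linD (@ip_linear _)) subrr.
Qed.

End Step.

Lemma ad_specP i : ad_spec i.
Proof. by elim: i => [|i]; [exact: ad_spec0 | exact: ad_specS]. Qed.

End OneSidedAdjoint.

(** * Linear maps out of the direct sum *)

Section DirectSum.
Variables (k : fieldType) (P : standard_pentad k).
Local Notation L := (Lsum P).

Definition prj n (x : L) : Vn P n := val x n.

Lemma prj_linear n : linear (@prj n).
Proof. by []. Qed.

Lemma LsumP (x y : L) : (forall n, prj n x = prj n y) -> x = y.
Proof. by move=> xy; apply/val_inj/functional_extensionality_dep. Qed.

Lemma prj_inj n (z : Vn P n) : prj n (inj z) = z.
Proof.
rewrite /prj /= /inj_fun; case: eqP => // e.
by rewrite (eq_irrelevance e erefl).
Qed.

Lemma prj_inj_neq n m (z : Vn P n) : n != m -> prj m (inj z) = 0.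
Proof. by rewrite /prj /= /inj_fun; case: eqP. Qed.

Lemma inj_linear n : linear (@inj k P n).
Proof.
move=> c z z'; apply: LsumP => m; rewrite prj_linear.
have [<-|nm] := eqVneq n m; first by rewrite !prj_inj.
by rewrite !prj_inj_neq // scaler0 addr0.
Qed.

Lemma inj_eq0 n (z : Vn P n) : inj z = 0 -> z = 0.
Proof. by move=> z0; rewrite -(prj_inj z) z0. Qed.

(** Transports between equal degrees disappear in [L], so identities between brackets are stated
    there. *)
Lemma inj_cast n m (e : n = m) (z : Vn P n) : inj (castV e z) = inj z.
Proof. by case: m / e. Qed.

Lemma supp_finite (x : L) : finite_set (supp (val x)).
Proof. by apply/asboolP; exact: valP x. Qed.

Lemma suppN (x : L) n : ~ supp (val x) n -> prj n x = 0.
Proof. by rewrite /supp /= => /negP; rewrite negbK => /eqP. Qed.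

Section Lift.
Variable W : lmodType k.
Implicit Type f : forall n, Vn P n -> W.

Definition lift f (x : L) : W := \sum_(n \in supp (val x)) f n (prj n x).

(** Lifts of several vectors can thus be compared over one common range. *)
Lemma lift_seq f (r : seq int) (x : L) : (forall n, linear (f n)) ->
  uniq r -> (forall n, supp (val x) n -> n \in r) ->
  lift f x = \sum_(n <- r) f n (prj n x).
Proof.
move=> flin ur xr; rewrite [RHS]fsbig_seq //; apply: fsbig_widen => n.
  exact: xr.
by case=> _ /suppN /= ->; rewrite (lin0 (flin n)).
Qed.

Lemma lift_linear f : (forall n, linear (f n)) -> linear (lift f).
Proof.
move=> flin c x y.
pose r := enum_fset (fset_set (supp (val x) `|` supp (val y))%classic).
have rP n : n \in r = (n \in (supp (val x) `|` supp (val y))%classic).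
  by rewrite in_fset_set // finite_setU; split; exact: supp_finite.
rewrite !(lift_seq (r := r)) ?fset_uniq // => [|n|n|n].
- rewrite scaler_sumr -big_split; apply: eq_bigr => n _.
  by rewrite prj_linear flin.
- by move=> yn; rewrite rP inE; right.
- by move=> xn; rewrite rP inE; left.
- rewrite rP inE => xyn; apply: contrapT => /not_orP[/suppN xn /suppN yn].
  have : prj n (c *: x + y) != 0 by [].
  by rewrite prj_linear xn yn scaler0 addr0 eqxx.
Qed.

Lemma lift_inj f n (z : Vn P n) :
  (forall n, linear (f n)) -> lift f (inj z) = f n z.
Proof.
move=> flin; rewrite (lift_seq (r := [:: n])) // ?big_seq1 ?prj_inj //.
move=> m; rewrite inE eq_sym; apply: contraPT => nm /negP; apply.
by apply/eqP; exact: prj_inj_neq.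
Qed.

Lemma lift_param_linear (U : lmodType k) (f : U -> forall n, Vn P n -> W) x :
  (forall n z, linear (fun u => f u n z)) -> linear (fun u => lift (f u) x).
Proof.
move=> flin c u v; rewrite /lift !(fsbig_finite _ _ (supp_finite x)).
by rewrite scaler_sumr -big_split; apply: eq_bigr => n _; rewrite flin.
Qed.

End Lift.

Lemma lift_id (x : L) : lift (@inj k P) x = x.
Proof.
pose r := enum_fset (fset_set (supp (val x))).
have rP n : n \in r = (n \in supp (val x)).
  by rewrite in_fset_set //; exact: supp_finite.
rewrite (lift_seq (r := r)) ?fset_uniq //; last 2 first.
- exact: inj_linear.
- by move=> n xn; rewrite rP inE.
apply: LsumP => m; rewrite (lin_sum (@prj_linear m)).
have [mr|mr] := boolP (m \in r).
  rewrite (bigD1_seq m) ?fset_uniq //= prj_inj big1 ?addr0 // => n nm.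
  by rewrite prj_inj_neq.
rewrite big1_seq => [|n /= nr].
  by rewrite (suppN (n := m)) // => xm; rewrite rP (mem_set xm) in mr.
by rewrite prj_inj_neq //; apply: contraNneq mr => <-.
Qed.

Lemma Lsum_ind (Q : L -> Prop) : Q 0 -> (forall x y, Q x -> Q y -> Q (x + y)) ->
  (forall n (z : Vn P n), Q (inj z)) -> forall x, Q x.
Proof.
move=> Q0 QD Qinj x; rewrite -(lift_id x) /lift fsbig_finite; last first.
  exact: supp_finite.
by elim/big_ind: _.
Qed.

Lemma linear_ext (W : lmodType k) (f h : L -> W) : linear f -> linear h ->
  (forall n (z : Vn P n), f (inj z) = h (inj z)) -> f =1 h.
Proof.
move=> fl hl fh; apply: Lsum_ind => // [|x y xe ye].
  by rewrite (lin0 fl) (lin0 hl).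
by rewrite (linD fl) (linD hl) xe ye.
Qed.

Lemma Lcomp_subspace n : subspace (@Lcomp k P n).
Proof.
split; first by exists 0 => //; exact: lin0 (@inj_linear n).
move=> c _ _ [z _ <-] [z' _ <-]; exists (c *: z + z') => //.
exact: inj_linear.
Qed.

Lemma Lcomp_direct_sum : internal_direct_sum (@Lcomp k P).
Proof.
split=> [|x]; first exact: Lcomp_subspace.
have sE : [set n | inj (prj n x) != 0]%classic = supp (val x).
  apply/seteqP; split=> n /=; apply: contra_neq; last exact: inj_eq0.
  by move=> xn; rewrite (_ : prj n x = 0) // (lin0 (@inj_linear n)).
(* Uniqueness: [prj m] leaves only the term of index [m] of any other decomposition. *)
exists (fun n => inj (prj n x)); split.
  rewrite sE; split; [by move=> n; exists (prj n x)|exact: supp_finite|].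
  by rewrite -{1}(lift_id x).
move=> c [cc cfin ->]; apply/funext => m; have [z _ zE] := cc m.
rewrite -zE; congr inj; rewrite fsbig_finite // (lin_sum (@prj_linear m)).
have cN n : n != m -> prj m (c n) = 0.
  by move=> nm; have [z' _ <-] := cc n; rewrite prj_inj_neq.
have [mr|mr] := boolP (m \in fset_set [set n | c n != 0]%classic).
  by rewrite (bigD1_seq m) ?fset_uniq //= -zE prj_inj big1 ?addr0.
rewrite big1_seq => [|n /= nr]; last first.
  by apply: cN; apply: contraNneq mr => <-.
move: mr; rewrite in_fset_set // notin_setE /= => /negP; rewrite negbK -zE.
by move=> /eqP /inj_eq0.
Qed.

End DirectSum.

(** * The operators of degree -1, 0 and 1 *)

Section Relations.
Variables (k : fieldType) (g : lmodType k) (br : g -> g -> g).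
Variable D : moment_data br.
Local Notation A := (md_A D).
Local Notation B := (md_B D).
Local Notation V i := (gr_sort (gr D i)).
Variables (L : lmodType k) (i0 : g -> L) (ip : forall i, V i -> L).
Variables (H : g -> L -> L) (X : A -> L -> L) (Y : B -> L -> L).
Local Notation ib := (inj_below i0 ip).
Hypotheses (i0_linear : linear i0) (ip_linear : forall i, linear (@ip i))
  (H_linear : forall a, linear (H a)) (X_linear : forall x, linear (X x))
  (Y_linear : forall y, linear (Y y))
  (H_i0 : forall a b, H a (i0 b) = i0 (br a b))
  (H_ip : forall a i (z : V i), H a (ip z) = ip (gr_act a z))
  (X_ib : forall i x (b : gr_below D i), X x (ib b) = ip (below_map x b))
  (Y_ip : forall i y (z : V i), Y y (ip z) = - ib (gr_eval z y)).

Lemma ib_linear i : linear (@inj_below k g br D L i0 ip i).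
Proof. by case: i. Qed.

Lemma H_ib a i (b : gr_below D i) : H a (ib b) = ib (below_act a b).
Proof. by case: i b => [|i] b /=; rewrite ?H_i0 ?H_ip. Qed.

(** Equivariance of p_i; [HY_ip] is that of evaluation. With the two halves exchanged, they cover
    all degrees of [HX] and [HY]. *)
Lemma HX_ib a x i (b : gr_below D i) :
  H a (X x (ib b)) = X (md_actA a x) (ib b) + X x (H a (ib b)).
Proof.
by rewrite H_ib !X_ib H_ip below_map_equivariant (linD (@ip_linear i)).
Qed.

Lemma HY_ip a y i (z : V i) :
  H a (Y y (ip z)) = Y (md_actB a y) (ip z) + Y y (H a (ip z)).
Proof.
rewrite H_ip !Y_ip (linN (H_linear a)) H_ib gr_eval_equivariant.
by rewrite (linD (@ib_linear i)) addrC opprD.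
Qed.

(** The defining recursion of p, in the form [gr_mapE], is exactly this commutation relation. *)
Lemma XY_ip x y i (z : V i) :
  X x (Y y (ip z)) = H (md_mom x y) (ip z) + Y y (X x (ip z)).
Proof.
rewrite Y_ip (linN (X_linear x)) X_ib H_ip (X_ib (i := i.+1)) Y_ip.
rewrite [gr_eval (below_map _ _) _](_ : _ = gr_map x z y) // gr_mapE.
by rewrite /= (linD (@ip_linear i)) opprD addNKr.
Qed.

End Relations.

(** * Operators of a standard pentad and their commutation relations *)

Section Operators.
Variables (k : fieldType) (P : standard_pentad k).
Local Notation g := (sp_g P).
Local Notation A := (sp_V P).
Local Notation B := (sub_of (sp_dual P)).
Local Notation L := (Lsum P).

Definition inj_g : g -> L := @inj k P 0.
Definition inj_pos i : gr_sort (gr (posD P) i) -> L := @inj k P (Posz i.+1).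
Definition inj_neg i : gr_sort (gr (negD P) i) -> L := @inj k P (Negz i).

Local Notation i0 := inj_g.
Local Notation ip := inj_pos.
Local Notation iq := inj_neg.

Definition ad_g (a : g) : L -> L := lift (fun n z => inj (br0 a z)).
Definition ad_V (x : A) : L -> L := lift (fun n z => inj (br1 x z)).
Definition ad_dual (y : B) : L -> L := lift (fun n z => inj (brN1 y z)).

Local Notation H := ad_g.
Local Notation X := ad_V.
Local Notation Y := ad_dual.

Lemma br0_bilinear n : bilinear_map (@br0 k P n).
Proof.
case: n => [[|i]|i]; first exact: lie_bilinear (sp_lie P).
  exact: (rep_bilinear (gr_rep (gr (posD P) i))).
exact: (rep_bilinear (gr_rep (gr (negD P) i))).
Qed.

Lemma inj_br1_bilinear n : bilinear_map (fun x (z : Vn P n) => inj (br1 x z)).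
Proof.
case: n => [[|i]|[|i]].
- have [al ar] := bilinN (bilinS (rep_bilinear (sp_rho_rep P))).
  by split=> [a c x y|x c a b]; rewrite -inj_linear; congr inj;
    rewrite /br1 ?al ?ar.
- have [al ar] := im_map_bilinear (gr (posD P) i).
  by split=> [a c x y|x c a b]; rewrite -inj_linear; congr inj;
    rewrite /br1 ?al ?ar.
- have [al ar] := bilinN (bilinS (gr_eval_bilinear (negD P) 0)).
  by split=> [a c x y|x c a b]; rewrite -inj_linear; congr inj;
    rewrite /br1 ?al ?ar.
- have [al ar] := bilinN (bilinS (gr_eval_bilinear (negD P) i.+1)).
  by split=> [a c x y|x c a b]; rewrite /br1 !inj_cast -inj_linear; congr inj;
    rewrite ?al ?ar.
Qed.

Lemma inj_brN1_bilinear n : bilinear_map (fun y (z : Vn P n) => inj (brN1 y z)).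
Proof.
case: n => [[|[|i]]|i].
- have [al ar] := bilinN (bilinS (rep_bilinear (@sp_varrho_rep k P))).
  by split=> [a c x y|x c a b]; rewrite -inj_linear; congr inj;
    rewrite /brN1 ?al ?ar.
- have [al ar] := bilinN (bilinS (gr_eval_bilinear (posD P) 0)).
  by split=> [a c x y|x c a b]; rewrite -inj_linear; congr inj;
    rewrite /brN1 ?al ?ar.
- have [al ar] := bilinN (bilinS (gr_eval_bilinear (posD P) i.+1)).
  by split=> [a c x y|x c a b]; rewrite /brN1 !inj_cast -inj_linear; congr inj;
    rewrite ?al ?ar.
- have [al ar] := im_map_bilinear (gr (negD P) i).
  by split=> [a c x y|x c a b]; rewrite /brN1 !inj_cast -inj_linear; congr inj;
    rewrite ?al ?ar.
Qed.

Lemma lift_bilinear (U W : lmodType k) (f : U -> forall n, Vn P n -> W) :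
  (forall n, bilinear_map (fun u z => f u n z)) ->
  bilinear_map (fun u => lift (f u)).
Proof.
move=> fbil; split=> [x|u].
  by apply: lift_param_linear => n; have [] := fbil n.
by apply: lift_linear => n; have [_] := fbil n.
Qed.

Lemma inj_br0_bilinear n : bilinear_map (fun a (z : Vn P n) => inj (br0 a z)).
Proof.
have [al ar] := br0_bilinear n.
by split=> [z c a b|a c z z']; rewrite -inj_linear; congr inj; rewrite ?al ?ar.
Qed.

Lemma H_bilinear : bilinear_map H.
Proof. exact: lift_bilinear inj_br0_bilinear. Qed.

Lemma X_bilinear : bilinear_map X.
Proof. exact: lift_bilinear inj_br1_bilinear. Qed.

Lemma Y_bilinear : bilinear_map Y.
Proof. exact: lift_bilinear inj_brN1_bilinear. Qed.

Lemma H_inj a n (z : Vn P n) : H a (inj z) = inj (br0 a z).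
Proof. by apply: lift_inj => m; have [_] := inj_br0_bilinear m. Qed.

Lemma X_inj x n (z : Vn P n) : X x (inj z) = inj (br1 x z).
Proof. by apply: lift_inj => m; have [_] := inj_br1_bilinear m. Qed.

Lemma Y_inj y n (z : Vn P n) : Y y (inj z) = inj (brN1 y z).
Proof. by apply: lift_inj => m; have [_] := inj_brN1_bilinear m. Qed.

Lemma i0_linear : linear i0.
Proof. exact: (@inj_linear k P 0). Qed.

Lemma ip_linear i : linear (@ip i).
Proof. exact: (@inj_linear k P (Posz i.+1)). Qed.

Lemma iq_linear i : linear (@iq i).
Proof. exact: (@inj_linear k P (Negz i)). Qed.

Local Notation ibp := (inj_below (D := posD P) i0 ip).
Local Notation ibq := (inj_below (D := negD P) i0 iq).

Lemma H_i0 a b : H a (i0 b) = i0 (sp_br a b).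
Proof. exact: H_inj. Qed.

Lemma H_ip a i (z : gr_sort (gr (posD P) i)) : H a (ip z) = ip (gr_act a z).
Proof. exact: (H_inj a (n := Posz i.+1)). Qed.

Lemma H_iq a i (z : gr_sort (gr (negD P) i)) : H a (iq z) = iq (gr_act a z).
Proof. exact: (H_inj a (n := Negz i)). Qed.

Lemma X_ibp i x (b : gr_below (posD P) i) :
  X x (ibp b) = ip (below_map (D := posD P) x b).
Proof.
case: i b => [|i] b; first exact: (X_inj x (n := 0)).
exact: (X_inj x (n := Posz i.+1)).
Qed.

Lemma X_iq i x (z : gr_sort (gr (negD P) i)) : X x (iq z) = - ibq (gr_eval z x).
Proof.
rewrite /inj_neg X_inj; case: i z => [|i] z; rewrite /br1 ?inj_cast.
  exact: (linN (@inj_linear k P 0)).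
exact: (linN (@inj_linear k P (Negz i))).
Qed.

Lemma Y_ibq i y (b : gr_below (negD P) i) :
  Y y (ibq b) = iq (below_map (D := negD P) y b).
Proof.
case: i b => [|i] b; first exact: (Y_inj y (n := 0)).
by rewrite /= /inj_neg Y_inj /brN1 inj_cast.
Qed.

Lemma Y_ip i y (z : gr_sort (gr (posD P) i)) : Y y (ip z) = - ibp (gr_eval z y).
Proof.
rewrite /inj_pos Y_inj; case: i z => [|i] z; rewrite /brN1 ?inj_cast.
  exact: (linN (@inj_linear k P 0)).
exact: (linN (@inj_linear k P (Posz i.+1))).
Qed.

Lemma X_iq0 x y : X x (iq (i := 0) y) = i0 (sp_Phi x y).
Proof.
by rewrite X_iq /= /sp_Psi (linN i0_linear) opprK.
Qed.

Lemma Y_ip0 y x : Y y (ip (i := 0) x) = i0 (sp_Psi y x).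
Proof. by rewrite Y_ip /= /sp_Psi (linN i0_linear). Qed.

Lemma X_i0 x a : X x (i0 a) = - ip (i := 0) (sp_rho a x).
Proof. by rewrite (X_ibp (i := 0)) -(linN (@inj_linear k P 1)). Qed.

Lemma Y_i0 y a : Y y (i0 a) = - iq (i := 0) (sp_varrho a y).
Proof. by rewrite (Y_ibq (i := 0)) -(linN (@inj_linear k P (Negz 0))). Qed.

Let Hl a : linear (H a). Proof. exact: H_bilinear.2. Qed.
Let Xl x : linear (X x). Proof. exact: X_bilinear.2. Qed.
Let Yl y : linear (Y y). Proof. exact: Y_bilinear.2. Qed.

Lemma comp_linear (U V W : lmodType k) (f : V -> W) (h : U -> V) :
  linear f -> linear h -> linear (fun u => f (h u)).
Proof. by move=> fl hl c u v; rewrite hl fl. Qed.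

Lemma add_linear (U W : lmodType k) (f h : U -> W) :
  linear f -> linear h -> linear (fun u => f u + h u).
Proof. by move=> fl hl c u v; rewrite hl fl scalerDr addrACA. Qed.

Lemma opp_linear (U W : lmodType k) (f : U -> W) :
  linear f -> linear (fun u => - f u).
Proof. by move=> fl c u v; rewrite fl opprD scalerN. Qed.

Lemma HX a x w : H a (X x w) = X (sp_rho a x) w + X x (H a w).
Proof.
apply: (linear_ext (f := fun w => H a (X x w))
  (h := fun w => X (sp_rho a x) w + X x (H a w))).
- exact: comp_linear.
- by apply: add_linear => //; exact: comp_linear.
move=> [[|i]|i] z.
- exact: (HX_ib (D := posD P) ip_linear H_i0 H_ip X_ibp a x (i := 0)).
- exact: (HX_ib (D := posD P) ip_linear H_i0 H_ip X_ibp a x (i := i.+1)).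
- exact: (HY_ip (D := negD P) i0_linear iq_linear Hl H_i0 H_iq X_iq).
Qed.

Lemma HY a y w : H a (Y y w) = Y (sp_varrho a y) w + Y y (H a w).
Proof.
apply: (linear_ext (f := fun w => H a (Y y w))
  (h := fun w => Y (sp_varrho a y) w + Y y (H a w))).
- exact: comp_linear.
- by apply: add_linear => //; exact: comp_linear.
move=> [[|i]|i] z.
- exact: (HX_ib (D := negD P) iq_linear H_i0 H_iq Y_ibq a y (i := 0)).
- exact: (HY_ip (D := posD P) i0_linear ip_linear Hl H_i0 H_ip Y_ip).
- exact: (HX_ib (D := negD P) iq_linear H_i0 H_iq Y_ibq a y (i := i.+1)).
Qed.

Lemma HH a b w : H (sp_br a b) w = H a (H b w) - H b (H a w).
Proof.
apply: (linear_ext (f := H (sp_br a b))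
  (h := fun w => H a (H b w) - H b (H a w))).
- exact: Hl.
- by apply: add_linear; [|apply: opp_linear]; exact: comp_linear.
move=> n z; rewrite !H_inj -(linB (@inj_linear k P n)); congr inj.
case: n z => [[|i]|i] z; last 2 first.
- exact: (rep_bracket (gr_rep (gr (posD P) i))).
- exact: (rep_bracket (gr_rep (gr (negD P) i))).
by rewrite /= (lie_leibniz (sp_lie P) a) addrK.
Qed.

Lemma XY x y w : X x (Y y w) = H (sp_Phi x y) w + Y y (X x w).
Proof.
apply: (linear_ext (f := fun w => X x (Y y w))
  (h := fun w => H (sp_Phi x y) w + Y y (X x w))).
- exact: comp_linear.
- by apply: add_linear => //; exact: comp_linear.
move=> [[|i]|i] z.
(* In degree 0 the relation is the equivariance of [sp_Phi]. *)
- rewrite -/(i0 z) Y_i0 X_i0 (linN (Xl x)) (linN (Yl y)) X_iq0 Y_ip0 H_i0.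
  rewrite (lie_skew (sp_lie P) _ z) sp_Phi_equivariant /sp_Psi.
  by rewrite !(linN i0_linear) (linD i0_linear); abel.
- exact: (XY_ip (D := posD P) ip_linear Xl H_ip X_ibp Y_ip).
(* The mirrored relation involves [sp_Psi y x], minus [sp_Phi x y], hence is equivalent. *)
- have := XY_ip (D := negD P) iq_linear Yl H_iq Y_ibq X_iq y x z.
  move=> ->; rewrite /= /sp_Psi (linN (H_bilinear.1 _)).
  by rewrite addNKr.
Qed.

Lemma ip_inj i (z : gr_sort (gr (posD P) i)) : ip z = 0 -> z = 0.
Proof. exact: (@inj_eq0 k P (Posz i.+1)). Qed.

Lemma iq_inj i (z : gr_sort (gr (negD P) i)) : iq z = 0 -> z = 0.
Proof. exact: (@inj_eq0 k P (Negz i)). Qed.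

(** V_{-n-1} is spanned by the images of V_{-n} under the operators [Y y], so vanishing spreads
    downwards from V_{-1}. *)
Lemma pos_ext (f : L -> L) : linear f ->
  (forall y, f (iq (i := 0) y) = 0) -> (forall a, f (i0 a) = 0) ->
  (forall i (z : gr_sort (gr (posD P) i)), f (ip z) = 0) ->
  (forall y w, Y y (f w) = f (Y y w)) -> forall w, f w = 0.
Proof.
move=> fl fB f0 fp fY; apply: (linear_ext (h := fun=> 0)) => //.
  by move=> c u v; rewrite scaler0 addr0.
case=> [[|i]|i] z; [exact: f0 | exact: fp |].
rewrite -/(iq z); elim: i z => [|i IHi]; first exact: fB.
apply: im_ind => [|z z' e e'|y z].
- by rewrite (lin0 (@iq_linear _)) (lin0 fl).
- by rewrite (linD (@iq_linear _)) (linD fl) e e' addr0.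
- rewrite [iq _](_ : _ = Y y (iq z)); last by rewrite (Y_ibq (i := i.+1)).
  by rewrite -fY IHi (lin0 (Y_bilinear.2 y)).
Qed.

Lemma neg_ext (f : L -> L) : linear f ->
  (forall x, f (ip (i := 0) x) = 0) -> (forall a, f (i0 a) = 0) ->
  (forall i (z : gr_sort (gr (negD P) i)), f (iq z) = 0) ->
  (forall x w, X x (f w) = f (X x w)) -> forall w, f w = 0.
Proof.
move=> fl fA f0 fn fX; apply: (linear_ext (h := fun=> 0)) => //.
  by move=> c u v; rewrite scaler0 addr0.
case=> [[|i]|i] z; [exact: f0 | | exact: fn].
rewrite -/(ip z); elim: i z => [|i IHi]; first exact: fA.
apply: im_ind => [|z z' e e'|x z].
- by rewrite (lin0 (@ip_linear _)) (lin0 fl).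
- by rewrite (linD (@ip_linear _)) (linD fl) e e' addr0.
- rewrite [ip _](_ : _ = X x (ip z)); last by rewrite (X_ibp (i := i.+1)).
  by rewrite -fX IHi (lin0 (X_bilinear.2 x)).
Qed.

Lemma YX y x w : Y y (X x w) = H (sp_Psi y x) w + X x (Y y w).
Proof. by rewrite XY /sp_Psi (linN (H_bilinear.1 _)) addKr. Qed.

Lemma pos_spec i : ad_spec (D := posD P) i0 (iq (i := 0)) ip H X Y i.
Proof.
apply: ad_specP.
- exact: ip_linear.
- exact: ip_inj.
- exact: H_bilinear.
- exact: X_bilinear.
- exact: Y_bilinear.
- exact: X_ibp.
- exact: X_iq0.
- exact: Y_ip.
- exact: HX.
- exact: XY.
- exact: pos_ext.
Qed.

Lemma neg_spec i : ad_spec (D := negD P) i0 (ip (i := 0)) iq H Y X i.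
Proof.
apply: ad_specP.
- exact: iq_linear.
- exact: iq_inj.
- exact: H_bilinear.
- exact: Y_bilinear.
- exact: X_bilinear.
- exact: Y_ibq.
- exact: Y_ip0.
- exact: X_iq.
- exact: HY.
- exact: YX.
- exact: neg_ext.
Qed.

(** * The bracket expressed by adjoint operators *)

Local Notation adp := (ad (D := posD P) X).
Local Notation adn := (ad (D := negD P) Y).

(** Both sides follow one recursion over the same representatives and agree termwise once [inj]
    absorbs the casts. *)
Lemma inj_br_pos i n (z : gr_sort (gr (posD P) i)) (w : Vn P n) :
  inj (br_pos z w) = adp z (inj w).
Proof.
elim: i n z w => [|i IHi] n z w; first by rewrite /= X_inj.
rewrite [br_pos _ _]/= (lin_sum (@inj_linear k P _)) /=.
apply: eq_bigr => xz _; rewrite (linB (@inj_linear k P _)) !inj_cast.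
by rewrite -X_inj !IHi -X_inj.
Qed.

Lemma inj_br_neg i n (z : gr_sort (gr (negD P) i)) (w : Vn P n) :
  inj (br_neg z w) = adn z (inj w).
Proof.
elim: i n z w => [|i IHi] n z w; first by rewrite /= Y_inj.
rewrite [br_neg _ _]/= (lin_sum (@inj_linear k P _)) /=.
apply: eq_bigr => yz _; rewrite (linB (@inj_linear k P _)) !inj_cast.
by rewrite -Y_inj !IHi -Y_inj.
Qed.

Definition adV (n : int) : Vn P n -> L -> L :=
  match n return Vn P n -> L -> L with
  | Posz 0 => H
  | Posz i.+1 => @ad _ _ _ (posD P) L X i
  | Negz i => @ad _ _ _ (negD P) L Y i
  end.

Lemma inj_brV n m (z : Vn P n) (w : Vn P m) : inj (brV z w) = adV z (inj w).
Proof.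
case: n z => [[|i]|i] z; rewrite /brV.
- by rewrite inj_cast -H_inj.
- exact: inj_br_pos.
- exact: inj_br_neg.
Qed.

Lemma adV_bilinear n : bilinear_map (@adV n).
Proof.
case: n => [[|i]|i]; first exact: H_bilinear.
  exact: ad_bilinear (pos_spec i).
exact: ad_bilinear (neg_spec i).
Qed.

Lemma lift_comp (f : L -> L) x :
  linear f -> lift (fun n z => f (inj z)) x = f x.
Proof.
move=> fl; apply: (linear_ext (f := lift (fun n z => f (inj z)))) => //.
  apply: lift_linear => n c z z'; by rewrite inj_linear fl.
move=> n z; apply: lift_inj => m c u v; by rewrite inj_linear fl.
Qed.

Lemma LbrE x y : Lbr x y = lift (fun n z => adV z y) x.
Proof.
rewrite [LHS](_ : _ = lift (fun n z => lift (fun m w => inj (brV z w)) y) x) //.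
rewrite /lift !(fsbig_finite _ _ (supp_finite x)); apply: eq_bigr => n _.
rewrite -[RHS](lift_comp y ((adV_bilinear n).2 _)) /lift.
rewrite !(fsbig_finite _ _ (supp_finite y)); apply: eq_bigr => m _.
exact: inj_brV.
Qed.

Lemma Lbr_bilinear : bilinear_map (@Lbr k P).
Proof.
have lb : bilinear_map (fun y x => @Lbr k P x y).
  have [ll lr] := lift_bilinear (fun n => bilinS (adV_bilinear n)).
  by split=> [x c y y'|y c x x']; rewrite !LbrE ?ll ?lr.
exact: bilinS lb.
Qed.

Lemma Lbr_inj n (z : Vn P n) y : Lbr (inj z) y = adV z y.
Proof. by rewrite LbrE lift_inj // => m; have [] := adV_bilinear m. Qed.

Lemma Lbr_i0 a w : Lbr (i0 a) w = H a w.
Proof. exact: (@Lbr_inj 0). Qed.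

Lemma Lbr_ip i (z : gr_sort (gr (posD P) i)) w : Lbr (ip z) w = adp z w.
Proof. exact: (@Lbr_inj (Posz i.+1)). Qed.

Lemma Lbr_iq i (z : gr_sort (gr (negD P) i)) w : Lbr (iq z) w = adn z w.
Proof. exact: (@Lbr_inj (Negz i)). Qed.

Lemma Lbr_ibp i (b : gr_below (posD P) i) w :
  Lbr (ibp b) w = adb (D := posD P) H X b w.
Proof. by case: i b => [|i] b; [exact: Lbr_i0 | exact: Lbr_ip]. Qed.

Lemma Lbr_ibq i (b : gr_below (negD P) i) w :
  Lbr (ibq b) w = adb (D := negD P) H Y b w.
Proof. by case: i b => [|i] b; [exact: Lbr_i0 | exact: Lbr_iq]. Qed.

(** V_{i+2} is by construction spanned by brackets of V_1 with V_{i+1}, and symmetrically below 0.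
    This also serves as the induction principle for [ad_homP] and [skewP]. *)
Lemma Lbr_generated (S : set L) : lie_subalgebra (@Lbr k P) S ->
  (forall y, S (iq (i := 0) y)) -> (forall a, S (i0 a)) ->
  (forall x, S (ip (i := 0) x)) -> forall w, S w.
Proof.
move=> [[S0 SL] Sbr] Sm Sz Sp.
have SD u v : S u -> S v -> S (u + v).
  by move=> Su Sv; have := SL 1 _ _ Su Sv; rewrite scale1r.
apply: Lsum_ind => // -[[|i]|i] z; first exact: Sz.
- rewrite -/(ip z); elim: i z => [|i IHi]; first exact: Sp.
  apply: im_ind => [|z z' Su Su'|x z].
  + by rewrite (lin0 (@ip_linear _)).
  + by rewrite (linD (@ip_linear _)); exact: SD.
  + have := Sbr _ _ (Sp x) (IHi z).
    by rewrite Lbr_ip /= (X_ibp (i := i.+1)).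
- rewrite -/(iq z); elim: i z => [|i IHi]; first exact: Sm.
  apply: im_ind => [|z z' Su Su'|y z].
  + by rewrite (lin0 (@iq_linear _)).
  + by rewrite (linD (@iq_linear _)); exact: SD.
  + have := Sbr _ _ (Sm y) (IHi z).
    by rewrite Lbr_iq /= (Y_ibq (i := i.+1)).
Qed.

(** * The Lie algebra axioms *)

Let bl (v : L) : linear (fun u => Lbr u v).
Proof. exact: Lbr_bilinear.1. Qed.

Let bR (u : L) : linear (Lbr u).
Proof. exact: Lbr_bilinear.2. Qed.

(** The Jacobi identity in a form that can be used before antisymmetry is known. *)
Definition ad_hom (u : L) : Prop := forall w v,
  Lbr (Lbr u w) v = Lbr u (Lbr w v) - Lbr w (Lbr u v).

Lemma ad_hom_ext (u : L) :
  (forall n (z : Vn P n) v,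
    Lbr (Lbr u (inj z)) v = Lbr u (Lbr (inj z) v) - Lbr (inj z) (Lbr u v)) ->
  ad_hom u.
Proof.
move=> uh w v; move: w; apply: linear_ext => [||n z]; last exact: uh.
  exact: (comp_linear (bl v) (bR u)).
apply: add_linear; first exact: (comp_linear (bR u) (bl v)).
exact/opp_linear/(bl (Lbr u v)).
Qed.

Lemma ad_homP u : ad_hom u.
Proof.
apply: (Lbr_generated (S := ad_hom)) => [|y|a|x]; first split; first split.
- by move=> w v; rewrite !(lin0 (bl _)) (lin0 (bR _)) subr0.
- move=> c u1 u2 h1 h2 w v; rewrite !bl bR h1 h2 scalerBr.
  by rewrite opprD addrACA.
(* Every adjoint operator of a bracket expands into a commutator, leaving nested brackets that
   cancel. *)
- move=> u1 u2 h1 h2 w v; rewrite !(h1 u2) (linB (bl v)).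
  rewrite (h1 (Lbr u2 w)) (h2 (Lbr u1 w)) !(h1 w) !(h2 w) !(linB (bR _)); abel.
(* For [y], [ad_below] settles the degrees up to 0, where the bracket is q, and [ad_Y] the positive
   ones, where it is evaluation. *)
- apply: ad_hom_ext => n z v; rewrite !Lbr_iq /=.
  case: n z => [[|i]|i] z.
  + rewrite -/(i0 z) (Y_ibq (i := 0)) Lbr_iq !Lbr_i0.
    exact: (ad_below (neg_spec 0)).
  + rewrite -/(ip z) Y_ip (linN (bl v)) Lbr_ibp !Lbr_ip.
    by rewrite (ad_Y (pos_spec i)) addrAC subrr add0r.
  + rewrite -/(iq z) (Y_ibq (i := i.+1)) !Lbr_iq.
    exact: (ad_below (neg_spec i.+1)).
- apply: ad_hom_ext => n z v; rewrite !Lbr_i0.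
  case: n z => [[|i]|i] z.
  + by rewrite -/(i0 z) H_i0 !Lbr_i0 HH.
  + by rewrite -/(ip z) H_ip !Lbr_ip (ad_H (pos_spec i)) addrK.
  + by rewrite -/(iq z) H_iq !Lbr_iq (ad_H (neg_spec i)) addrK.
- apply: ad_hom_ext => n z v; rewrite !Lbr_ip /=.
  case: n z => [[|i]|i] z.
  + rewrite -/(i0 z) (X_ibp (i := 0)) Lbr_ip !Lbr_i0.
    exact: (ad_below (pos_spec 0)).
  + rewrite -/(ip z) (X_ibp (i := i.+1)) !Lbr_ip.
    exact: (ad_below (pos_spec i.+1)).
  + rewrite -/(iq z) X_iq (linN (bl v)) Lbr_ibq !Lbr_iq.
    by rewrite (ad_Y (neg_spec i)) addrAC subrr add0r.
Qed.

Definition skew (u : L) : Prop := forall w, Lbr u w = - Lbr w u.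

Lemma skew_ext (u : L) :
  (forall n (z : Vn P n), Lbr u (inj z) = - Lbr (inj z) u) -> skew u.
Proof.
move=> us; apply: linear_ext => //.
exact/opp_linear/(bl u).
Qed.

Lemma skewP u : skew u.
Proof.
apply: (Lbr_generated (S := skew)) => [|y|a|x]; first split; first split.
- by move=> w; rewrite (lin0 (bl _)) (lin0 (bR _)) oppr0.
- move=> c u1 u2 h1 h2 w; rewrite bl bR h1 h2 scalerN.
  by rewrite opprD.
(* By [ad_homP], [Lbr w] is a derivation, so antisymmetry of [u1] and [u2] suffices. *)
- move=> u1 u2 h1 h2 w; rewrite ad_homP.
  have -> : Lbr w (Lbr u1 u2) = Lbr (Lbr w u1) u2 + Lbr u1 (Lbr w u2).
    by rewrite ad_homP subrK.
  have e1 v : Lbr v u1 = - Lbr u1 v by rewrite h1 opprK.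
  have e2 v : Lbr v u2 = - Lbr u2 v by rewrite h2 opprK.
  rewrite (e2 (Lbr w u1)) (e2 w) (e1 w) (linN (bR u1)) (linN (bR u2)); abel.
- apply: skew_ext => n z; rewrite Lbr_iq /=; case: n z => [[|i]|i] z.
  + by rewrite -/(i0 z) Lbr_i0 Y_i0 H_iq.
  + by rewrite -/(ip z) Y_ip Lbr_ip (ad_iB (pos_spec i)).
  + by rewrite -/(iq z) (Y_ibq (i := i.+1)) Lbr_iq (ad_ip0 (neg_spec i)) opprK.
- apply: skew_ext => n z; rewrite Lbr_i0; case: n z => [[|i]|i] z.
  + rewrite -/(i0 z) Lbr_i0 !H_i0 -(linN i0_linear).
    by rewrite -(lie_skew (sp_lie P)).
  + by rewrite -/(ip z) H_ip Lbr_ip (ad_i0 (pos_spec i)) opprK.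
  + by rewrite -/(iq z) H_iq Lbr_iq (ad_i0 (neg_spec i)) opprK.
- apply: skew_ext => n z; rewrite Lbr_ip /=; case: n z => [[|i]|i] z.
  + by rewrite -/(i0 z) Lbr_i0 X_i0 H_ip.
  + by rewrite -/(ip z) (X_ibp (i := i.+1)) Lbr_ip (ad_ip0 (pos_spec i)) opprK.
  + by rewrite -/(iq z) X_iq Lbr_iq (ad_iB (neg_spec i)).
Qed.

(** Antisymmetry does not give this in characteristic 2. From degree 2 on, [Y y] sends [z, z] to
    -[z, z(y)] - [z(y), z] = 0 and transitivity applies; degree 1 rests on [im_map0_diag], and
    negative degrees are symmetric. *)
Lemma Lbr_inj_diag n (z : Vn P n) : Lbr (inj z) (inj z) = 0.
Proof.
case: n z => [[|i]|i] z.
- rewrite -/(i0 z) Lbr_i0 H_i0 (lie_alternating (sp_lie P)).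
  exact: lin0 i0_linear.
- rewrite -/(ip z) Lbr_ip; case: i z => [|i] z.
    rewrite /= (X_ibp (i := 1)) [below_map _ _](im_map0_diag z).
    exact: lin0 (@ip_linear _).
  have [u e] := ad_ip (pos_spec i.+1) z z; rewrite e.
  apply: (ip_transitive ip_linear ip_inj Y_ip) => y.
  rewrite -e (ad_Y (pos_spec _)) Y_ip -Lbr_ibp -Lbr_ip (linN (bR _)).
  by rewrite [Lbr (ibp _) _]skewP opprK addNr.
- rewrite -/(iq z) Lbr_iq; case: i z => [|i] z.
    rewrite /= (Y_ibq (i := 1)) [below_map _ _](im_map0_diag z).
    exact: lin0 (@iq_linear _).
  have [u e] := ad_ip (neg_spec i.+1) z z; rewrite e.
  apply: (ip_transitive iq_linear iq_inj X_iq) => y.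
  rewrite -e (ad_Y (neg_spec _)) X_iq -Lbr_ibq -Lbr_iq (linN (bR _)).
  by rewrite [Lbr (ibq _) _]skewP opprK addNr.
Qed.

Lemma Lbr_diag (u : L) : Lbr u u = 0.
Proof.
elim/Lsum_ind: u => [|u v hu hv|n z]; last exact: Lbr_inj_diag.
  exact: lin0 (bR 0).
rewrite (linD (bl _)) !(linD (bR _)) hu hv addr0 add0r.
by rewrite [Lbr u v]skewP addNr.
Qed.

Lemma Lbr_jacobi (u v w : L) :
  Lbr u (Lbr v w) + Lbr v (Lbr w u) + Lbr w (Lbr u v) = 0.
Proof.
rewrite [Lbr w (Lbr u v)]skewP ad_homP [Lbr w u]skewP (linN (bR v)); abel.
Qed.

Lemma Lbr_lie : lie_bracket (@Lbr k P).
Proof.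
by split; [exact: Lbr_bilinear | exact: Lbr_diag | exact: Lbr_jacobi].
Qed.

End Operators.

Theorem theorem2p15 (k : fieldType) (P : standard_pentad k) :
  (forall (n m : int) (x : Vn P n) (y : Vn P m),
     Lbr (inj x) (inj y) = inj (brV x y)) /\
  graded_lie_algebra (@Lbr k P) (@Lcomp k P).
Proof.
have brE (n m : int) (x : Vn P n) (y : Vn P m) :
    Lbr (inj x) (inj y) = inj (brV x y) by rewrite Lbr_inj inj_brV.
split=> //; split; [exact: Lbr_lie | exact: Lcomp_direct_sum | |].
- by move=> n m _ _ [x _ <-] [y _ <-]; rewrite brE; exists (brV x y).
- move=> S Salg Sm Sz Sp; apply: Lbr_generated => // z.
  + by apply: Sm; exists z.
  + by apply: Sz; exists z.
  + by apply: Sp; exists z.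
Qed.
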